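(* Let $q_0=(x_0,y_0,z_0,w_0)\in\mathbb{R}^4$ and $q_1=(x_1,y_1,z_1,w_1)\in\mathbb{R}^4$. Assume that $z_1-z_0=J_F(x_0,y_0)+J_F(x_1,-y_1)$ and $w_1-w_0\ge T_F(x_0,y_0)+T_F(x_1,-y_1)$. Put $t_1=w_1-w_0$ and let $(x_F(t),y_F(t))$, $t\in[0,t_1]$, be an optimal trajectory in the finite-time Fuller problem $$\frac12\int_0^{t_1}x^2\,dt\to\min,\quad \dot x=y,\ \dot y=u,\ |u|\le 1,\quad x(0)=x_0,\ y(0)=y_0,\ x(t_1)=x_1,\ y(t_1)=y_1.$$ Put $$z_F(t)=z_0+\frac12\int_0^t x_F^2(s)\,ds,\qquad w_F(t)=w_0+t.$$ Then the trajectory $(x_F(t),y_F(t),z_F(t),w_F(t))$, $t\in[0,t_1]$, is the unique shortest path connecting $q_0$ to $q_1$ in the Finsler problem on $\mathbb{R}^4=\{q=(x,y,z,w)\}$ with the norm $$\|\xi\|=\max(|\xi_2|,|\xi_4|)+|\xi_1-y\xi_4|+|\xi_3-\tfrac12x^2\xi_4|,\qquad \xi=(\xi_1,\xi_2,\xi_3,\xi_4)\in T_q\mathbb{R}^4.$$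
   Context: Fuller problem: for $(x_0,y_0)\in\mathbb{R}^2$, minimize $\frac12\int_0^{+\infty}x^2\,dt$ subject to $\dot x=y$, $\dot y=u$, $|u|\le1$, $x(0)=x_0$, $y(0)=y_0$ (measurable control $u$). It is known that for each $(x_0,y_0)$ there is a unique optimal trajectory $(x(t),y(t),u(t))$, and there is a finite time $T_F(x_0,y_0)\ge 0$ such that $x(t)=y(t)=u(t)=0$ for all $t\ge T_F(x_0,y_0)$ while $|u(t)|=1$ for almost all $t\in[0,T_F(x_0,y_0)]$. This defines $T_F$. Define $$J_F(x_0,y_0)=\inf\Big\{\tfrac12\int_0^\infty x^2\,dt\ \Big|\ x(0)=x_0,\ \dot x(0)=y_0,\ |\ddot x|\le1\Big\}.$$ The length of an absolutely continuous curve $q(\cdot)$ is $\int\|\dot q\|\,dt$; the Finsler distance is the infimum of lengths of curves connecting two points, equivalently the infimum of times $T$ for which there is a curve with $\|\dot q\|\le 1$ a.e., $q(0)=q_0$, $q(T)=q_1$. Shortest paths are considered in this time-optimal (natural) parameterization. The unit ball of the norm at $q$ is the hyperoctahedron $\mathrm{conv}(\pm f_1\pm f_2;\pm f_3;\pm f_6)$ with $f_1(q)=(y,0,\frac12x^2,1)$, $f_2=(0,1,0,0)$, $f_3=(-1,0,0,0)$, $f_6=(0,0,1,0)$. *)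

(* Defs.v *)
From HB Require Import structures.
From mathcomp Require Export all_boot all_order all_algebra.
From mathcomp Require Export all_classical all_reals all_analysis.
Export Order.TTheory GRing.Theory Num.Theory.
Export numFieldNormedType.Exports.

Set Implicit Arguments.
Unset Strict Implicit.
Unset Printing Implicit Defensive.

Local Open Scope classical_set_scope.
Local Open Scope ring_scope.

Definition abs_continuous (R : realType) (V : normedModType R) (a b : R)
    (f : R -> V) : Prop :=
  forall e : R, 0 < e -> exists2 d : R, 0 < d &
    forall (n : nat) (s t : 'I_n -> R),
      (forall i, [/\ a <= s i, s i <= t i & t i <= b]) ->
      (forall i j, i != j -> t i <= s j \/ t j <= s i) ->
      \sum_(i < n) (t i - s i) < d ->
      \sum_(i < n) `|f (t i) - f (s i)| < e.

(** * The Fuller problem *)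

(* Caratheodory solutions on [0, T] of x' = y, y' = u, |u| <= 1. *)
Definition fuller_traj (R : realType) (x0 y0 T : R) (x y u : R -> R) : Prop :=
  [/\ measurable_fun `[0, T] u /\ (forall t, 0 <= t <= T -> `|u t| <= 1),
      abs_continuous 0 T x /\ abs_continuous 0 T y,
      {ae @lebesgue_measure R, forall t : R, 0 < t < T ->
         is_derive t 1 x (y t) /\ is_derive t 1 y (u t)}
    & x 0 = x0 /\ y 0 = y0].

Definition fuller_traj_infty (R : realType) (x0 y0 : R) (x y u : R -> R) : Prop :=
  forall T : R, 0 <= T -> fuller_traj x0 y0 T x y u.

Definition fuller_cost (R : realType) (T : R) (x : R -> R) : \bar R :=
  ((2^-1 : R)%:E * \int[@lebesgue_measure R]_(t in `[0%R, T]) (x t ^+ 2)%:E)%E.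

Definition fuller_cost_infty (R : realType) (x : R -> R) : \bar R :=
  ((2^-1 : R)%:E * \int[@lebesgue_measure R]_(t in `[0%R, +oo[) (x t ^+ 2)%:E)%E.

Definition fuller_optimal_infty (R : realType) (x0 y0 : R) (x y u : R -> R) : Prop :=
  fuller_traj_infty x0 y0 x y u /\
  forall x' y' u' : R -> R, fuller_traj_infty x0 y0 x' y' u' ->
    (fuller_cost_infty x <= fuller_cost_infty x')%E.

(* The velocity x'(0) = y0 and the acceleration bound |x''| <= 1 are expressed
   through y = x' and u = x''. *)
Definition J_F (R : realType) (x0 y0 : R) : \bar R :=
  ereal_inf [set c | exists x y u : R -> R,
    fuller_traj_infty x0 y0 x y u /\ c = fuller_cost_infty x].

Definition fuller_stop_time (R : realType) (x0 y0 T : R) : Prop :=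
  0 <= T /\
  exists x y u : R -> R,
    [/\ fuller_optimal_infty x0 y0 x y u,
        forall t, T <= t -> [/\ x t = 0, y t = 0 & u t = 0]
      & {ae @lebesgue_measure R, forall t : R, 0 <= t <= T -> `|u t| = 1}].

(* By Fuller's theorem exactly one T satisfies [fuller_stop_time x0 y0 T];
   the infimum picks out that T. *)
Definition T_F (R : realType) (x0 y0 : R) : \bar R :=
  ereal_inf [set T%:E | T in fuller_stop_time x0 y0].

Definition fuller_traj_between (R : realType) (x0 y0 x1 y1 T : R)
    (x y u : R -> R) : Prop :=
  [/\ fuller_traj x0 y0 T x y u, x T = x1 & y T = y1].

Definition fuller_optimal_between (R : realType) (x0 y0 x1 y1 T : R)
    (x y : R -> R) : Prop :=
  (exists u : R -> R, fuller_traj_between x0 y0 x1 y1 T x y u) /\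
  forall x' y' u' : R -> R, fuller_traj_between x0 y0 x1 y1 T x' y' u' ->
    (fuller_cost T x <= fuller_cost T x')%E.

(** * The Finsler problem on R^4 *)

(* The coordinates x, y, z, w have indices 0, 1, 2, 3. *)
Definition vec4 (R : realType) (x y z w : R) : 'rV[R]_4 :=
  \row_(i < 4) [:: x; y; z; w]`_i.

Definition finsler_norm (R : realType) (q xi : 'rV[R]_4) : R :=
  Num.max `|xi 0 1| `|xi 0 3| + `|xi 0 0 - q 0 1 * xi 0 3|
    + `|xi 0 2 - 2^-1 * q 0 0 ^+ 2 * xi 0 3|.

(* An absolutely continuous curve is differentiable almost everywhere by
   Lebesgue's theorem; the third clause only records this. *)
Definition curve_between (R : realType) (q0 q1 : 'rV[R]_4) (T : R)
    (q : R -> 'rV[R]_4) : Prop :=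
  [/\ 0 <= T, abs_continuous 0 T q,
      {ae @lebesgue_measure R, forall t : R, 0 < t < T -> derivable q t 1},
      q 0 = q0
    & q T = q1].

Definition finsler_speed (R : realType) (q : R -> 'rV[R]_4) (t : R) : R :=
  finsler_norm (q t) ('D_1 q t).

Definition curve_length (R : realType) (T : R) (q : R -> 'rV[R]_4) : \bar R :=
  (\int[@lebesgue_measure R]_(t in `]0%R, T[) (finsler_speed q t)%:E)%E.

Definition finsler_dist (R : realType) (q0 q1 : 'rV[R]_4) : \bar R :=
  ereal_inf [set l | exists (T : R) (q : R -> 'rV[R]_4),
    curve_between q0 q1 T q /\ l = curve_length T q].

(* Length minimizers in the time-optimal parameterization: speed at most 1,
   and the total time equals the length. *)
Definition shortest_path (R : realType) (q0 q1 : 'rV[R]_4) (T : R)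
    (q : R -> 'rV[R]_4) : Prop :=
  [/\ curve_between q0 q1 T q,
      curve_length T q = finsler_dist q0 q1,
      {ae @lebesgue_measure R, forall t : R, 0 < t < T ->
         finsler_speed q t <= 1}
    & T%:E = curve_length T q].

(* Main.v *)
Require Import Defs.
From mathcomp Require Import all_boot all_order all_algebra.
From mathcomp Require Import all_classical all_reals all_analysis.
From mathcomp Require Import measurable_realfun.
From mathcomp Require Import ring lra.

(** The fourth coordinate of a curve moves no faster than the curve itself, so
    every curve from q0 to q1 has length at least w1 - w0
    ([curve_length_ge]).  The lift of a Fuller trajectory has speed one and
    spends all of it on the fourth coordinate ([fuller_lift_curve]); when it
    ends at q1 it is therefore a shortest path.  Conversely, a curve of speed at
    most one that gains w1 - w0 in its fourth coordinate during the time w1 - w0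
    has no speed left for anything else: w grows at rate one, |y'| <= 1, x' = y
    and z' = x^2 / 2, so that the curve is the lift of a Fuller trajectory
    ([unit_speed_curve_lift]), whose cost is z1 - z0.  Everything thus reduces
    to showing that only one Fuller trajectory from (x0, y0) to (x1, y1) in time
    w1 - w0 has cost at most z1 - z0 = J_F(x0, y0) + J_F(x1, -y1)
    ([fuller_between_unique]).

    This is a matter of convexity.  Let X0 be the optimal trajectory from
    (x0, y0) and X1 the one from (x1, -y1), at rest at the origin after the
    times T0 and T1, where T0 + T1 <= T = w1 - w0.  As X0(t) and X1(T - t) are
    never both nonzero, X(t) = X0(t) + X1(T - t) goes from (x0, y0) to (x1, y1)
    with cost J_F(x0, y0) + J_F(x1, -y1) ([concat_fuller_traj], [concat_cost]).
    If x is any trajectory with the same ends and d = x - X, then d and d'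
    vanish at both ends, so d extends by zero to all times.  For small k > 0 the
    function X0 + k d is again an admissible trajectory from (x0, y0): before T0
    it is a convex combination of X0 and x, and after T0 it is the small
    function k d.  Optimality of X0 then gives that the integral of X0 d is
    nonnegative ([optimal_variation]).  Reversing time gives the same for X1, so
    the integral of X d is nonnegative and the integral of x^2 exceeds that of
    X^2 by at least that of d^2 ([concat_strictly_optimal]).  The same variation
    shows that the optimal trajectory of the infinite horizon is unique, hence
    that the infimum T_F is itself a time after which it rests
    ([T_F_attained]).

    The analytic tool is a comparison of increments for absolutely continuous
    functions by means of their almost everywhere derivatives
    ([abs_continuous_le]); together with Lebesgue differentiation it bounds the
    increment of w by the length. *)

Set Implicit Arguments.
Unset Strict Implicit.
Unset Printing Implicit Defensive.

Import Order.TTheory GRing.Theory Num.Theory.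
Import numFieldNormedType.Exports.

Local Open Scope classical_set_scope.
Local Open Scope ring_scope.

#[local] Instance ae_lebesgue_filter (R : realType) :
  Filter (nbhs (almost_everywhere (@lebesgue_measure R))) :=
  ae_filter_ringOfSetsType (@lebesgue_measure R).

(** * Absolutely continuous functions *)

Section AbsCont.
Context {R : realType}.
Implicit Types (a b c k : R) (f g : R -> R).

Lemma abs_continuousS (V : normedModType R) a b a' b' (f : R -> V) :
  a <= a' -> b' <= b -> abs_continuous a b f -> abs_continuous a' b' f.
Proof.
move=> aa bb acf e e0; have [d d0 H] := acf e e0; exists d => // n s t st.
apply: H => i; have [h1 h2 h3] := st i.
by split => //; [exact: le_trans h1|exact: le_trans bb].
Qed.

(** Comparing increments is how absolute continuity passes to coordinates,
    multiples and vector-valued functions below. *)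
Lemma abs_continuous_dominated (V W : normedModType R) a b k
    (f : R -> V) (g : R -> W) :
  0 <= k ->
  (forall s t, a <= s -> s <= t -> t <= b -> `|f t - f s| <= k * `|g t - g s|) ->
  abs_continuous a b g -> abs_continuous a b f.
Proof.
move=> k0 fg acg e e0.
have k1 : 0 < k + 1 by rewrite ltr_wpDl.
have [d d0 H] := acg (e / (k + 1)) (divr_gt0 e0 k1); exists d => // n s t st dis sd.
have := H n s t st dis sd; rewrite ltr_pdivlMr// => /(le_lt_trans _); apply.
rewrite mulr_suml; apply: ler_sum => i _; have [h1 h2 h3] := st i.
rewrite (le_trans (fg _ _ h1 h2 h3))// mulrC ler_wpM2l// lerDl//.
Qed.

Lemma abs_continuousD (V : normedModType R) a b (f g : R -> V) :
  abs_continuous a b f -> abs_continuous a b g ->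
  abs_continuous a b (fun t => f t + g t).
Proof.
move=> acf acg e e0.
have e2 : 0 < e / 2 by rewrite divr_gt0.
have [d d0 H] := acf _ e2; have [d' d'0 H'] := acg _ e2.
exists (Num.min d d'); first by rewrite lt_min d0.
move=> n s t st dis; rewrite lt_min => /andP[sd sd'].
rewrite [ltRHS]splitr; apply: le_lt_trans (ltrD (H _ _ _ st dis sd) (H' _ _ _ st dis sd')).
rewrite -big_split; apply: ler_sum => i _.
by rewrite opprD addrACA; exact: ler_normD.
Qed.

Lemma abs_continuousZ a b k f :
  abs_continuous a b f -> abs_continuous a b (fun t => k * f t).
Proof.
apply: (@abs_continuous_dominated _ _ _ _ `|k|) => // s t _ _ _.
by rewrite -mulrBr normrM.
Qed.

Lemma abs_continuousN a b f :
  abs_continuous a b f -> abs_continuous a b (fun t => - f t).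
Proof.
apply: (@abs_continuous_dominated _ _ _ _ 1) => // s t _ _ _.
by rewrite -opprD normrN mul1r.
Qed.

Lemma abs_continuousB a b f g :
  abs_continuous a b f -> abs_continuous a b g ->
  abs_continuous a b (fun t => f t - g t).
Proof. by move=> acf /abs_continuousN; exact: abs_continuousD. Qed.

Lemma abs_continuous_id a b : abs_continuous a b (fun t : R => t).
Proof.
move=> e e0; exists e => // n s t st _; apply: le_lt_trans.
by apply: ler_sum => i _; have [_ h _] := st i; rewrite ger0_norm// subr_ge0.
Qed.

Lemma abs_continuous_lipschitz a b k f : 0 <= k ->
  (forall s t, a <= s -> s <= t -> t <= b -> `|f t - f s| <= k * (t - s)) ->
  abs_continuous a b f.
Proof.
move=> k0 fk; apply: (@abs_continuous_dominated _ _ _ _ k) (@abs_continuous_id a b) => //.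
by move=> s t sa st tb; rewrite (ger0_norm (_ : 0 <= t - s)) ?subr_ge0//; exact: fk.
Qed.

Lemma abs_continuous_eq (V : normedModType R) a b (f g : R -> V) :
  (forall t, a <= t <= b -> f t = g t) ->
  abs_continuous a b f -> abs_continuous a b g.
Proof.
move=> fg; apply: (@abs_continuous_dominated _ _ _ _ 1) => // s t sa st tb.
by rewrite mul1r !fg// ?sa ?tb ?(le_trans st)// (le_trans sa).
Qed.

(** Freezing a function at time b.  When it vanishes there, this is its
    extension by zero to a longer horizon, with no case distinction. *)
Lemma abs_continuous_min a b c f : a <= b ->
  abs_continuous a b f -> abs_continuous a c (fun t => f (Num.min t b)).
Proof.
move=> ab acf e e0; have [d d0 H] := acf e e0; exists d => // n s t st dis sd.
apply: (H n (fun i => Num.min (s i) b) (fun i => Num.min (t i) b)).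
- move=> i; have [h1 h2 h3] := st i.
  split; first by rewrite le_min h1 ab.
    by case: (ltP (s i) b); case: (ltP (t i) b); lra.
  by rewrite ge_min lexx orbT.
- by move=> i j /dis [ts|ts]; [left|right];
    [case: (ltP (s j) b); case: (ltP (t i) b)|
     case: (ltP (s i) b); case: (ltP (t j) b)]; lra.
- apply: le_lt_trans sd; apply: ler_sum => i _; have [h1 h2 h3] := st i.
  by case: (ltP (s i) b); case: (ltP (t i) b); lra.
Qed.

Lemma abs_continuous_reflect c f :
  abs_continuous 0 c f -> abs_continuous 0 c (fun t => f (c - t)).
Proof.
move=> acf e e0; have [d d0 H] := acf e e0; exists d => // n s t st dis sd.
under eq_bigr do rewrite distrC.
apply: (H n (fun i => c - t i) (fun i => c - s i)).
- by move=> i; have [h1 h2 h3] := st i; split; lra.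
- by move=> i j /dis [ts|ts]; [right|left]; lra.
- by apply: le_lt_trans sd; apply: ler_sum => i _; lra.
Qed.

Lemma abs_continuous_dist a b f : abs_continuous a b f ->
  forall e, 0 < e -> exists2 d, 0 < d & forall s t,
    a <= s <= b -> a <= t <= b -> `|t - s| < d -> `|f t - f s| < e.
Proof.
move=> acf e e0; have [d d0 H] := acf e e0; exists d => // s t.
wlog st : s t / s <= t.
  move=> W sab tab; have [|/ltW ts] := leP s t; first by move/W; apply.
  by rewrite distrC [`|f t - _|]distrC; exact: W.
move=> /andP[as_ _] /andP[_ tb]; rewrite ger0_norm ?subr_ge0// => std.
have := H 1%N (fun=> s) (fun=> t); rewrite !big_ord1; apply => //.
by move=> i j; rewrite !ord1.
Qed.

Lemma abs_continuous_within a b f :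
  abs_continuous a b f -> {within `[a, b], continuous f}.
Proof.
move=> acf; apply/subspace_continuousP => x /=; rewrite in_itv/= => axb.
apply/cvgrPdist_lt => e e0; have [d d0 H] := abs_continuous_dist acf e0.
rewrite near_withinE; near=> t; rewrite /= in_itv/= => atb.
by apply: H => //; near: t; exact: nbhsx_ballx.
Unshelve. all: by end_near. Qed.

End AbsCont.

(** * Comparing increments through almost everywhere derivatives *)

Section Increments.
Context {R : realType}.
Notation mu := (@lebesgue_measure R).
Implicit Types (a b : R) (f g F : R -> R).

(** The first-order expansion avoids the quotient, so that it also holds at the
    base point and on both sides of it. *)
Lemma is_derive_expansion f (x D e : R) : is_derive x 1 f D -> 0 < e ->
  exists2 r, 0 < r &
    forall t, `|t - x| < r -> `|f t - f x - D * (t - x)| <= e * `|t - x|.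
Proof.
move=> [dfx <-] e0.
have : h^-1 *: (f (h *: 1 + x) - f x) @[h --> 0^'] --> 'D_1 f x by exact: dfx.
move=> /cvgrPdist_le /(_ _ e0) [r /= r0 H]; exists r => // t tx.
have [->|ntx] := eqVneq t x; first by rewrite !subrr mulr0 subrr normr0 mulr0.
have h0 : t - x != 0 by rewrite subr_eq0.
have := H (t - x); rewrite /= sub0r normrN => /(_ tx h0).
rewrite /GRing.scale /= mulr1 subrK => K.
have -> : f t - f x - 'D_1 f x * (t - x) =
    - (('D_1 f x - (t - x)^-1 * (f t - f x)) * (t - x)) by field.
by rewrite normrN normrM ler_wpM2r.
Qed.

(** Continuous induction: [P] holds at the supremum of the points where it holds,
    and also slightly beyond unless that supremum is b. *)
Lemma locally_transfer_itv (P : R -> Prop) a b : a <= b -> P a ->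
  (forall x, a <= x <= b -> exists2 d, 0 < d & forall s t, a <= s -> t <= b ->
    x - d < s -> s <= x -> x <= t -> t < x + d -> P s -> P t) ->
  P b.
Proof.
move=> ab Pa step.
pose S := [set x | a <= x <= b /\ P x].
have Sa : S a by rewrite /S /= lexx ab.
have Sb : ubound S b by move=> x [/andP[]].
have hS : has_sup S by split; [exists a|exists b].
have aS : a <= sup S by apply: ub_le_sup => //; case: hS.
have cb : sup S <= b by apply: ge_sup => //; exists a.
have [d d0 H] := step (sup S) (introT andP (conj aS cb)).
have [s [/andP[as_ sb] Ps] ds] := sup_adherent d0 hS.
have ss : s <= sup S.
  by apply: ub_le_sup; [case: hS|split => //; rewrite as_ sb].
pose t := Num.min b (sup S + d / 2).
have tb : t <= b by rewrite /t ge_min lexx.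
have td : t < sup S + d by rewrite /t gt_min; apply/orP; right; lra.
have st : sup S <= t by rewrite /t le_min cb /=; lra.
have Pt : P t by exact: (H s).
have : t <= sup S.
  by apply: ub_le_sup; [case: hS|split => //; rewrite tb (le_trans aS)].
rewrite {1}/t ge_min => /orP[bs|]; last by lra.
by have -> : b = t by apply/le_anti; rewrite tb (le_trans bs).
Qed.

Lemma lebesgue_null_open_cover (D : set R) (d : R) : measurable D -> mu D = 0%E ->
  0 < d -> exists U : set R, [/\ open U, D `<=` U & (mu U < d%:E)%E].
Proof.
move=> mD D0 d0.
have [|U [oU DU Ud]] := @lebesgue_regularity_outer _ D d mD _ d0.
  by rewrite [X in (X < _)%E]D0.
exists U; split => //; rewrite -(setDUK DU) setUC measureU0 => //.
by apply: measurableD => //; exact: open_measurable.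
Qed.

(** Near a point where the derivatives exist, the increment of f exceeds that of
    F by at most a small multiple of the length of the step.  The exceptional
    null set is covered by an open set U of small measure; a step inside U is
    charged to the variation of f, and absolute continuity keeps the sum of
    these charges small.  On such a step F is used through its monotonicity
    alone, so that the primitive of any nonnegative integrable function can take
    its place. *)
Lemma abs_continuous_le a b f F : a <= b -> abs_continuous a b f ->
  (forall s t, a <= s -> s <= t -> t <= b -> F s <= F t) ->
  {ae mu, forall t, a < t < b ->
    exists c d, [/\ is_derive t 1 f c, is_derive t 1 F d & c <= d]} ->
  f b - f a <= F b - F a.
Proof.
move=> ab acf Fnd [N [mN N0 HN]]; apply/ler_addgt0Pr => e e0.
have e2 : 0 < e / 2 by rewrite divr_gt0.
have [d d0 Hd] := acf _ e2.
(* the endpoints count as exceptional: derivatives are known strictly inside *)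
pose D := N `|` [set a] `|` [set b].
have mD : measurable D by apply: measurableU => //; exact: measurableU.
have muD : mu D = 0%E.
  rewrite measureU0 //; [|exact: measurableU|exact: lebesgue_measure_set1].
  by rewrite measureU0 //; exact: lebesgue_measure_set1.
have [U [oU DU Ud]] := lebesgue_null_open_cover mD muD d0.
have mU : measurable U by exact: open_measurable.
pose m x := fine (mu (U `&` `]a, x])).
have mUx x : measurable (U `&` `]a, x]) by exact: measurableI.
have mUd x : (mu (U `&` `]a, x]) < d%:E)%E.
  apply: le_lt_trans Ud; apply: le_measure;
    [by rewrite inE; exact: mUx|by rewrite inE; exact: mU|exact: subIsetl].
have mfin x : mu (U `&` `]a, x]) \is a fin_num.
  by rewrite ge0_fin_numE// (lt_trans (mUd x))// ltry.
have m_mono s t : s <= t -> m s <= m t.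
  move=> st; apply: fine_le => //.
  apply: le_measure; [by rewrite inE; exact: mUx|by rewrite inE; exact: mUx|].
  by apply: setIS; apply: subset_itvl; rewrite bnd_simp.
have m_add s t : a <= s -> s <= t -> `]s, t] `<=` U -> m s + (t - s) <= m t.
  move=> as_ st stU; rewrite -lee_fin EFinD !fineK//.
  have -> : (t - s)%:E = mu `]s, t].
    rewrite lebesgue_measure_itv/= lte_fin.
    by case: (ltgtP s t) st => // -> _; rewrite subrr.
  rewrite -(measureU mu (mUx s) (measurable_itv `]s, t]))//.
    apply: le_measure; [|by rewrite inE; exact: mUx|].
      by rewrite inE; apply: measurableU; [exact: mUx|exact: measurable_itv].
    move=> x [[Ux]|xst]; rewrite /= !in_itv/=.
      by move=> /andP[ax xs]; split => //; rewrite ax (le_trans xs).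
    split; first exact: stU.
    by move: xst; rewrite /= in_itv/= => /andP[sx ->]; rewrite (le_lt_trans as_).
  apply/seteqP; split => // x [[_]]; rewrite /= !in_itv/= => /andP[_ xs] /andP[].
  by rewrite ltNge xs.
have k0 : 0 < e / 2 / (b - a + 1) by rewrite divr_gt0// ltr_wpDl// subr_ge0.
set k := e / 2 / (b - a + 1) in k0.
(* l collects the steps made inside U; bounding their total length by m x, not
   just by the measure of U, is what keeps the induction going *)
pose P x := exists l : seq (R * R),
  [/\ all (fun p => [&& a <= p.1, p.1 <= p.2 & p.2 <= x]) l,
      pairwise (fun p q => (p.2 <= q.1) || (q.2 <= p.1)) l,
      \sum_(p <- l) (p.2 - p.1) <= m x
    & f x - f a <= F x - F a + k * (x - a) + \sum_(p <- l) `|f p.2 - f p.1| ].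
have Pa : P a.
  exists [::]; rewrite !big_nil !subrr mulr0 !addr0; split => //.
  exact: fine_ge0.
have step x : a <= x <= b -> exists2 r, 0 < r & forall s t, a <= s -> t <= b ->
    x - r < s -> s <= x -> x <= t -> t < x + r -> P s -> P t.
  move=> /andP[ax xb]; have [Ux|Ux] := pselect (U x).
    have [r /= r0 rU] : nbhs x U by exact: open_nbhs_nbhs.
    exists r => // s t as_ tb xs sx xt tx [l [l1 l2 l3 l4]].
    have st : s <= t by exact: le_trans xt.
    exists ((s, t) :: l); rewrite !big_cons /=; split.
    - rewrite as_ st lexx /=; apply: sub_all l1 => p /and3P[-> -> /=].
      by move=> /le_trans; apply.
    - rewrite l2 andbT; apply: sub_all l1 => p /and3P[_ _ ->].
      by rewrite orbT.
    - rewrite addrC; apply: le_trans (m_add _ _ as_ st _); first by rewrite lerD2r.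
      move=> y; rewrite /= in_itv/= => /andP[sy yt]; apply: rU => /=.
      by rewrite ltr_distlC; apply/andP; split; lra.
    - have := ler_norm (f t - f s); have := Fnd s t as_ st tb.
      have : 0 <= k * (t - s) by rewrite mulr_ge0 ?subr_ge0// ltW.
      rewrite !mulrBr; lra.
  have axb : a < x < b.
    rewrite !lt_def ax xb !andbT; apply/andP; split; apply/eqP => xE; apply: Ux; apply: DU.
      by left; right.
    by right.
  have [c [c' [fc Fc' cc']]] : exists c d, [/\ is_derive x 1 f c, is_derive x 1 F d & c <= d].
    have : ~ N x by move=> Nx; apply: Ux; apply: DU; left; left.
    by apply: contra_notP => xg; apply: HN => /=; apply: contra_not xg; apply.
  have k2 : 0 < k / 2 by rewrite divr_gt0.
  have [r r0 fr] := is_derive_expansion fc k2.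
  have [r' r'0 Fr'] := is_derive_expansion Fc' k2.
  exists (Num.min r r'); first by rewrite lt_min r0.
  move=> s t as_ tb; rewrite ltrBlDl -ltrBlDr lt_min => /andP[sr sr'] sx xt.
  rewrite -ltrBlDl lt_min => /andP[tr tr'] [l [l1 l2 l3 l4]].
  have st : s <= t by exact: le_trans xt.
  exists l; split => //.
  - apply: sub_all l1 => p /and3P[-> -> /=].
    by move=> /le_trans; apply.
  - exact: le_trans (m_mono _ _ st).
  - have ns : `|s - x| = x - s by rewrite distrC ger0_norm ?subr_ge0.
    have nt : `|t - x| = t - x by rewrite ger0_norm ?subr_ge0.
    have /(_ _)/ler_normlP[|f1 f2] := fr s; first by rewrite ns.
    have /(_ _)/ler_normlP[|f3 f4] := fr t; first by rewrite nt.
    have /(_ _)/ler_normlP[|F1 F2] := Fr' s; first by rewrite ns.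
    have /(_ _)/ler_normlP[|F3 F4] := Fr' t; first by rewrite nt.
    rewrite !ns !nt in f1 f2 f3 f4 F1 F2 F3 F4.
    have : c * (t - s) <= c' * (t - s) by rewrite ler_wpM2r// subr_ge0.
    lra.
have [l [l1 l2 l3 l4]] := locally_transfer_itv ab Pa step.
have : \sum_(p <- l) `|f p.2 - f p.1| < e / 2.
  rewrite (big_nth (0, 0)) big_mkord.
  apply: (Hd _ (fun i => (nth (0, 0) l i).1) (fun i => (nth (0, 0) l i).2)).
  - by move=> i; have /and3P[] := allP l1 _ (mem_nth (0, 0) (ltn_ord i)).
  - move=> i j ij; wlog ltij : i j ij / (i < j)%N.
      move=> W; have := ij; rewrite neq_ltn => /orP[|ji]; first exact: W.
      by apply/or_comm; apply: W => //; rewrite eq_sym.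
    have /(pairwiseP (0, 0)) := l2 => /(_ i j (ltn_ord i) (ltn_ord j) ltij).
    by move=> /orP.
  - apply: le_lt_trans (_ : m b < d).
      by move: l3; rewrite (big_nth (0, 0)) big_mkord.
    by rewrite -lte_fin fineK.
have : k * (b - a) <= e / 2.
  by rewrite /k -mulrA ler_piMr ?(ltW e2)// mulrC ler_pdivrMr; lra.
lra.
Qed.

End Increments.

(** * Measurability of derivatives and time reversal *)

Section MeasurableDerivative.
Context {R : realType}.
Notation mu := (@lebesgue_measure R).
Implicit Types (a b : R) (f g F : R -> R).

Lemma abs_continuous_in a b f : abs_continuous a b f ->
  {in `]a, b[%classic, continuous f}.
Proof.
move=> /abs_continuous_within cf x; rewrite inE/= in_itv/= => axb.
have ab : a < b by case/andP: axb; exact: lt_trans.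
have /(continuous_within_itvP _ ab)[cf' _ _] := cf.
by apply: cf'; rewrite in_itv.
Qed.

(** The derivative is a limit of difference quotients.  These are formed with f
    cut off outside I, as f is only known to be measurable there. *)
Lemma measurable_derivative (I D : set R) f (f' : R -> R) :
  open I -> measurable D -> D `<=` I -> {in I, continuous f} ->
  (forall t, D t -> is_derive t 1 f (f' t)) -> measurable_fun D f'.
Proof.
move=> oI mD DI cf df.
have mI : measurable I by exact: open_measurable.
have mfI : measurable_fun setT (f \_ I).
  apply/(measurable_restrictT _ _).1 => //.
  exact: open_continuous_measurable_fun.
pose h (n : nat) t := n.+1%:R * ((f \_ I) (t + n.+1%:R^-1) - (f \_ I) t).
apply: (@measurable_fun_cvg _ _ _ D h) => [n|t Dt].
  apply: measurable_funTS; apply: measurable_funM => //.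
  apply: measurable_funB => //.
  apply: (measurableT_comp mfI); exact: measurable_funD.
have It := DI _ Dt.
have [r' /= r'0 rI] : nbhs t I by exact: open_nbhs_nbhs.
apply/cvgrPdist_le => e e0.
have [r r0 fr] := is_derive_expansion (df t Dt) e0.
have rr : 0 < Num.min r r' by rewrite lt_min r0.
near=> n.
have n0 : (0 : R) < n.+1%:R^-1 by rewrite invr_gt0.
have nr : n.+1%:R^-1 < Num.min r r'.
  by near: n; exact: (near_infty_natSinv_lt (PosNum rr)).
move: nr; rewrite lt_min => /andP[nr nr'].
rewrite /h !patchE !mem_set//; last first.
  by apply: rI => /=; rewrite opprD addrA subrr sub0r normrN gtr0_norm.
have := fr (t + n.+1%:R^-1); rewrite (addrC t) addrK gtr0_norm// => /(_ nr) H.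
have N0 : (0 : R) < n.+1%:R by [].
rewrite distrC (_ : (n.+1%:R * _ - _) = n.+1%:R *
    (f (n.+1%:R^-1 + t) - f t - f' t * n.+1%:R^-1)); last first.
  by rewrite [RHS]mulrBr (mulrCA _ (f' t)) mulfV ?mulr1// pnatr_eq0.
by rewrite normrM (gtr0_norm N0) -ler_pdivlMl// [leRHS]mulrC.
Unshelve. all: by end_near. Qed.

(** Setting the derivative to 0 on a Borel null set makes it measurable and
    bounded everywhere, as a control has to be. *)
Lemma ae_derivative_selection (I : set R) f (Q : R -> R -> Prop) k :
  open I -> {in I, continuous f} -> 0 <= k ->
  {ae mu, forall t, I t -> exists2 c, `|c| <= k & is_derive t 1 f c /\ Q t c} ->
  exists u : R -> R, [/\ measurable_fun setT u, forall t, `|u t| <= k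
    & {ae mu, forall t, I t -> is_derive t 1 f (u t) /\ Q t (u t)}].
Proof.
move=> oI cf k0 [N [mN N0 HN]].
have mI : measurable I by exact: open_measurable.
have mD : measurable (I `\` N) by exact: measurableD.
have dD t : (I `\` N) t -> exists2 c, `|c| <= k & is_derive t 1 f c /\ Q t c.
  move=> [It]; apply: contra_notP => h; apply: HN => /=.
  by apply: contra_not h; exact.
have D1 t : (I `\` N) t ->
    [/\ `|'D_1 f t| <= k, is_derive t 1 f ('D_1 f t) & Q t ('D_1 f t)].
  by move=> /dD[c ck [fc qc]]; rewrite (@derive_val _ _ _ _ _ _ _ fc); split.
exists ((fun t => 'D_1 f t) \_ (I `\` N)); split.
- apply/(measurable_restrictT _ _).1 => //.
  apply: (measurable_derivative oI mD _ cf) => [t []|t /D1[]] //.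
- move=> t; rewrite patchE; case: ifPn => [|_]; last by rewrite normr0.
  by rewrite inE => /D1[].
- exists N; split => // t /= /not_implyP[It h]; apply: contrapT => Nt; apply: h.
  by rewrite patchE mem_set//; have [] := D1 t (conj It Nt).
Qed.

End MeasurableDerivative.

(** The codomain carries the Borel structure on which pushforwards of the
    Lebesgue measure are defined. *)
Definition reflection {R : realType} (c t : R) : measurableTypeR R := c - t.

Section Reflection.
Context {R : realType}.
Notation mu := (@lebesgue_measure R).
Variable c : R.

Lemma measurable_reflect : measurable_fun setT (reflection c : measurableTypeR R -> _).
Proof. by apply: measurable_funB. Qed.

Lemma lebesgue_measure_reflect (A : set R) : measurable A ->
  pushforward mu (reflection c) A = mu A.
Proof.
move=> mA; apply/esym/lebesgue_measure_unique => //=;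
  [exact: measurable_reflect|move=> _ _ [[a b]] _ <-].
rewrite /pushforward (_ : _ @^-1` _ = `[c - b, c - a[%classic).
  rewrite !lebesgue_measure_itv/= !lte_fin ltrD2l ltrN2 -!EFinB.
  by congr (if _ then (_%:E) else _); ring.
by apply/seteqP; split => x /=; rewrite /reflection !in_itv/= => /andP[? ?]; lra.
Qed.

Lemma ae_reflect (P : R -> Prop) :
  {ae mu, forall t, P t} -> {ae mu, forall t, P (c - t)}.
Proof.
move=> [N [mN N0 HN]]; exists (reflection c @^-1` N); split.
- by rewrite -[X in measurable X]setTI; exact: (measurable_reflect measurableT mN).
- by have := lebesgue_measure_reflect mN; rewrite N0.
- by move=> t /= Pt; exact: HN.
Qed.

End Reflection.

(** * Integrals over a bounded horizon *)

Section Integrals.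
Context {R : realType}.
Notation mu := (@lebesgue_measure R).
Implicit Types (S T : R) (f g x d : R -> R).

Lemma continuous_integrable_itv T f : {within `[0, T], continuous f} ->
  mu.-integrable `[0, T] (EFin \o f).
Proof.
by move=> cf; apply: continuous_compact_integrable => //; exact: segment_compact.
Qed.

Lemma within_continuousM T f g : {within `[0, T], continuous f} ->
  {within `[0, T], continuous g} -> {within `[0, T], continuous (fun t => f t * g t)}.
Proof. by move=> cf cg t; apply: continuousM; [exact: cf|exact: cg]. Qed.

Lemma fuller_costE T x : {within `[0, T], continuous x} ->
  fuller_cost T x = (2^-1 * \int[mu]_(t in `[0, T]) (x t * x t))%:E.
Proof.
move=> cx; rewrite /fuller_cost EFinM; congr (_ * _)%E.
rewrite fineK; last first.
  apply: integrable_fin_num => //; apply: continuous_integrable_itv.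
  exact: within_continuousM.
by apply: eq_integral => t _; rewrite expr2.
Qed.

Lemma fuller_cost_inftyE T x : {within `[0, T], continuous x} -> 0 <= T ->
  (forall t, T <= t -> x t = 0) -> fuller_cost_infty x = fuller_cost T x.
Proof.
move=> cx T0 x0; congr (_ * _)%E.
have mx : measurable_fun `[0, T] (EFin \o (fun t => x t ^+ 2)).
  have := continuous_integrable_itv (within_continuousM cx cx).
  move=> /integrableP[+ _]; apply: eq_measurable_fun => t _.
  by rewrite /= expr2.
have mx0 : measurable_fun `]T, +oo[ (EFin \o (fun t => x t ^+ 2)).
  apply: (@eq_measurable_fun _ _ _ _ _ (cst 0%E)) => // t.
  by rewrite inE /= in_itv/= andbT => Tt; rewrite x0 ?(ltW Tt)// expr0n.
rewrite (_ : `[0, +oo[%classic = `[0, T] `|` `]T, +oo[); last first.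
  by rewrite -itv_bndbnd_setU// bnd_simp.
rewrite ge0_integral_setU//=.
- rewrite [X in (_ + X)%E]integral0_eq ?adde0// => t.
  by rewrite /= in_itv/= andbT => Tt; rewrite x0 ?(ltW Tt)// expr0n.
- by apply/measurable_funU.
- by move=> t _; rewrite lee_fin sqr_ge0.
- apply/disj_setPS => t [] /=; rewrite !in_itv/= andbT => /andP[_ tT].
  by rewrite ltNge tT.
Qed.

Lemma Rintegral_reflect T f : 0 <= T -> {within `[0, T], continuous f} ->
  \int[mu]_(t in `[0, T]) f (T - t) = \int[mu]_(t in `[0, T]) f t.
Proof.
rewrite le_eqVlt => /predU1P[<- _|T0 cf].
  by rewrite set_itv1 !Rintegral_set1.
have dF (t : R) : is_derive t 1 (fun s => T - s) (-1).
  have := is_deriveB (is_derive_cst T t 1) (is_derive_id t 1).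
  by rewrite sub0r.
have dFE : derive1 (fun s => T - s) = cst (-1).
  by apply/funext => t; rewrite derive1E (@derive_val _ _ _ _ _ _ _ (dF t)).
have := @integration_by_substitution_decreasing R (fun s => T - s) f 0 T.
rewrite subrr subr0 => subst; rewrite /Rintegral subst //.
- by congr fine; apply: eq_integral => t _; rewrite !fctE dFE /= opprK mulr1.
- exact: ltW.
- by move=> x y _ _ xy; rewrite ler_ltB.
- by rewrite dFE => ? ?; exact: cvg_cst.
- by rewrite dFE; exact: is_cvg_cst.
- by rewrite dFE; exact: is_cvg_cst.
- have cF t : {for t, continuous (fun s => T - s)}.
    by apply: differentiable_continuous; apply/derivable1_diffP; exact: ex_derive.
  split => /=.
  + by move=> t _; exact: ex_derive.
  + by apply: cvg_at_right_filter; exact: cF.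
  + by apply: cvg_at_left_filter; exact: cF.
Qed.

(** The primitive of d^2 is squeezed between 0 and its final value, so it
    vanishes and so does its derivative. *)
Lemma continuous_sq_integral_eq0 T d : {within `[0, T], continuous d} ->
  \int[mu]_(t in `[0, T]) (d t * d t) <= 0 -> forall t, 0 < t < T -> d t = 0.
Proof.
move=> cd d0 t /andP[t0 tT].
have cdd := within_continuousM cd cd.
have idd := continuous_integrable_itv cdd.
pose F s := \int[mu]_(r in `[0, s]) (d r * d r).
have Fge0 s : 0 <= F s by apply: Rintegral_ge0 => r _; rewrite -expr2 sqr_ge0.
have F0 s : 0 < s < T -> F s = 0.
  move=> /andP[s0 sT]; apply/le_anti; rewrite Fge0 andbT (le_trans _ d0)//.
  apply: fine_le.
  - apply: integrable_fin_num => //; apply: integrableS idd => //.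
    by apply: subset_itvl; rewrite bnd_simp ltW.
  - exact: integrable_fin_num.
  - apply: ge0_subset_integral => //; first by case/integrableP: idd.
      by move=> r _; rewrite lee_fin -expr2 sqr_ge0.
    by apply: subset_itvl; rewrite bnd_simp ltW.
have ctdd : {for t, continuous (fun r => d r * d r)}.
  have T0 : 0 < T by exact: lt_trans tT.
  have /(continuous_within_itvP _ T0)[+ _ _] := cdd.
  by apply; rewrite in_itv/= t0.
have [_ F't] := continuous_FTC1_closed tT idd t0 ctdd.
have : d t * d t = 0.
  rewrite -F't derive1E; transitivity ('D_1 (cst (0 : R)) t); last exact: derive_cst.
  apply: near_eq_derive; near=> s; apply: F0.
  have : s \in `]0, T[ by near: s; apply: near_in_itvoo; rewrite in_itv/= t0.
  by rewrite in_itv.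
by move/eqP; rewrite mulf_eq0 orbb => /eqP.
Unshelve. all: by end_near. Qed.

End Integrals.

(** * Controlled trajectories *)

Section Dynamics.
Context {R : realType}.
Notation mu := (@lebesgue_measure R).
Implicit Types (S T : R) (f g x y u d : R -> R).

Lemma is_derive_lincomb f g (k t a b : R) : is_derive t 1 f a -> is_derive t 1 g b ->
  is_derive t 1 (fun s => f s + k * g s) (a + k * b).
Proof. by move=> fa gb; exact: is_deriveD fa (is_deriveZ k gb). Qed.

Lemma is_derive_sub f g (t a b : R) : is_derive t 1 f a -> is_derive t 1 g b ->
  is_derive t 1 (fun s => f s - g s) (a - b).
Proof. by move=> fa gb; exact: is_deriveB fa gb. Qed.

Lemma is_derive_reflect f (c t a : R) : is_derive (c - t) 1 f a ->
  is_derive t 1 (fun s => f (c - s)) (- a).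
Proof.
move=> fa; have h : is_derive t 1 (fun s => c - s) (0 - 1).
  exact: is_derive_sub (is_derive_cst c t 1) (is_derive_id t 1).
by have := @is_derive1_comp R f (fun s => c - s) t a (0 - 1) fa h; rewrite sub0r mulrN1.
Qed.

Lemma is_deriveE f (t a : R) : is_derive t 1 f a -> 'D_1 f t = a.
Proof. by case. Qed.

Lemma is_derive_uniq f (t a b : R) : is_derive t 1 f a -> is_derive t 1 f b -> a = b.
Proof. by move=> [_ <-] [_ <-]. Qed.

Lemma ae_neq (a : R) : {ae mu, forall t, t <> a}.
Proof.
exists [set a]; split => //; first exact: lebesgue_measure_set1.
by move=> t /= /contrapT ->.
Qed.

Lemma abs_continuousB_within T f g :
  abs_continuous 0 T f -> abs_continuous 0 T g ->
  {within `[0, T], continuous (fun t => f t - g t)}.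
Proof. by move=> acf acg; apply: abs_continuous_within; exact: abs_continuousB. Qed.

(** Dynamics with the control left implicit: it is recovered from y by
    [ae_derivative_selection], so that trajectories can be assembled from pieces
    without constructing a measurable control each time. *)
Definition controlled (I : set R) x y :=
  {ae mu, forall t, I t -> is_derive t 1 x (y t) /\
    exists2 c, `|c| <= 1 & is_derive t 1 y c}.

Lemma control_exists (I : set R) x y : open I -> {in I, continuous y} ->
  controlled I x y -> exists u, [/\ measurable_fun setT u, forall t, `|u t| <= 1
    & {ae mu, forall t, I t -> is_derive t 1 x (y t) /\ is_derive t 1 y (u t)}].
Proof.
move=> oI cy xy.
have [|u [mu_ u1 H]] := @ae_derivative_selection _ I y
  (fun t _ => is_derive t 1 x (y t)) 1 oI cy ler01.
  by apply: filterS xy => t H /H[? [c ? ?]]; exists c.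
by exists u; split => //; apply: filterS H => t H /H[].
Qed.

Lemma fuller_traj_of_controlled (x0 y0 T : R) x y :
  abs_continuous 0 T x -> abs_continuous 0 T y -> controlled `]0, T[ x y ->
  x 0 = x0 -> y 0 = y0 -> exists u, fuller_traj x0 y0 T x y u.
Proof.
move=> acx acy xy xx yy.
have [|u [mu_ u1 H]] := control_exists _ (abs_continuous_in acy) xy.
  exact: interval_open.
exists u; split => //; first by split => //; exact: measurable_funTS.
Qed.

Lemma fuller_traj_infty_of_controlled (x0 y0 : R) x y :
  (forall T, abs_continuous 0 T x /\ abs_continuous 0 T y) ->
  controlled `]0, +oo[ x y -> x 0 = x0 -> y 0 = y0 ->
  exists u, fuller_traj_infty x0 y0 x y u.
Proof.
move=> acxy xy xx yy.
have [||u [mu_ u1 H]] := control_exists _ _ xy.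
- exact: interval_open.
- move=> t; rewrite inE/= in_itv/= andbT => t0.
  apply: (@abs_continuous_in _ 0 (t + 1)); first by case: (acxy (t + 1)).
  by rewrite inE/= in_itv/= t0 ltrDl ltr01.
exists u => T T0; have [acx acy] := acxy T.
split => //; first by split => //; exact: measurable_funTS.
by apply: filterS H => t; rewrite /= in_itv /= andbT => + /andP[t0 _]; apply.
Qed.

Lemma integral_sq_lincomb S f g k :
  {within `[0, S], continuous f} -> {within `[0, S], continuous g} ->
  \int[mu]_(t in `[0, S]) ((f t + k * g t) * (f t + k * g t)) =
  \int[mu]_(t in `[0, S]) (f t * f t) + 2 * k * \int[mu]_(t in `[0, S]) (f t * g t)
  + k ^+ 2 * \int[mu]_(t in `[0, S]) (g t * g t).
Proof.
move=> cf cg.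
have cZ (h : R -> R) (c : R) : {within `[0, S], continuous h} ->
    {within `[0, S], continuous (fun t => c * h t)}.
  by apply: within_continuousM => t; exact: cst_continuous.
have cD (h h' : R -> R) : {within `[0, S], continuous h} -> {within `[0, S], continuous h'} ->
    {within `[0, S], continuous (fun t => h t + h' t)}.
  by move=> ch ch' t; apply: continuousD; [exact: ch|exact: ch'].
have cff := within_continuousM cf cf.
have cfg := within_continuousM cf cg.
have cgg := within_continuousM cg cg.
have int (h : R -> R) : {within `[0, S], continuous h} -> mu.-integrable `[0, S] (EFin \o h).
  exact: continuous_integrable_itv.
have i1 := int _ cff.
have i2 := int _ (cZ _ (2 * k) cfg).
have i3 := int _ (cZ _ (k ^+ 2) cgg).
have i12 := int _ (cD _ _ cff (cZ _ (2 * k) cfg)).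
rewrite -(RintegralZl _ _ (int _ cfg))// -(RintegralZl _ _ (int _ cgg))//.
rewrite -(RintegralD _ i1 i2)// -(RintegralD _ i12 i3)//.
by apply: eq_Rintegral => t _; ring.
Qed.

(** The velocities agree almost everywhere, being derivatives of the same
    position, and they are continuous. *)
Lemma velocity_unique T x y x' y' :
  abs_continuous 0 T y -> abs_continuous 0 T y' ->
  {ae mu, forall t, 0 < t < T -> is_derive t 1 x (y t)} ->
  {ae mu, forall t, 0 < t < T -> is_derive t 1 x' (y' t)} ->
  (forall t, 0 < t < T -> x t = x' t) ->
  forall t, 0 < t < T -> y t = y' t.
Proof.
move=> acy acy' xy xy' xx t tT; apply/eqP; rewrite -subr_eq0; apply/eqP.
have cd := abs_continuousB_within acy acy'.
apply: (continuous_sq_integral_eq0 cd) t tT.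
rewrite /Rintegral (@ae_eq_integral _ _ _ mu _ (cst 0%E)) ?integral0//.
- by case/integrableP: (continuous_integrable_itv (within_continuousM cd cd)).
- have ae0T : {ae mu, forall t, t <> 0 /\ t <> T}.
    by apply: filterI; exact: ae_neq.
  suff : {ae mu, forall t, 0 <= t <= T -> (y t - y' t) * (y t - y' t) = 0}.
    by apply: filterS => t H /= tT; congr (_%:E); apply: H; move: tT; rewrite in_itv.
  apply: filterS3 xy xy' ae0T => t' xt xt' [t0 tT] /andP[t0' tT'].
  have tt : 0 < t' < T.
    by rewrite !lt_neqAle t0' tT' !andbT eq_sym; apply/andP; split; apply/eqP.
  have : is_derive t' 1 x (y' t').
    apply: near_eq_is_derive (xt' tt); near=> s; apply/esym/xx.
    have : s \in `]0, T[ by near: s; apply: near_in_itvoo; rewrite in_itv/=.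
    by rewrite in_itv.
  by move/(is_derive_uniq (xt tt)) => ->; rewrite subrr mul0r.
Unshelve. all: by end_near. Qed.

End Dynamics.

(** * First-order optimality condition for the infinite horizon *)

Section Fuller.
Context {R : realType}.
Notation mu := (@lebesgue_measure R).
Implicit Types (S T : R) (f g u d : R -> R).

Lemma fuller_traj_infty_abs_continuous x0 y0 x y u :
  fuller_traj_infty x0 y0 x y u ->
  forall T, abs_continuous 0 T x /\ abs_continuous 0 T y.
Proof.
move=> xyu T; have [_ [acx acy] _ _] := xyu `|T| (normr_ge0 T).
by split; [apply: abs_continuousS acx|apply: abs_continuousS acy];
  rewrite ?lexx// ler_norm.
Qed.

Lemma near_lt_eq (f g : R -> R) (a b t : R) : a < t < b ->
  (forall s, a < s < b -> f s = g s) -> \forall s \near t, f s = g s.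
Proof.
move=> tab fg; near=> s; apply: fg.
have : s \in `]a, b[ by near: s; apply: near_in_itvoo; rewrite in_itv.
by rewrite in_itv.
Unshelve. all: by end_near. Qed.

(** For 0 < k <= 1/2 the curve X + k d is admissible: before T0 its control is
    the convex combination (1 - k) U + k (U + c), and after T0 it is k c, with
    |k c| <= 1.  The bound 2 is that of a difference of two controls.  Comparing
    costs gives 2 k B + k^2 C >= 0 for the integrals B of X d and C of d^2,
    hence B >= 0. *)
Lemma optimal_variation x0 y0 X Y U S T0 d e :
  fuller_optimal_infty x0 y0 X Y U -> 0 <= S -> T0 <= S ->
  (forall t, T0 <= t -> X t = 0 /\ Y t = 0) ->
  abs_continuous 0 S d -> abs_continuous 0 S e ->
  {ae mu, forall t, 0 < t < S -> is_derive t 1 d (e t) /\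
     exists c, [/\ is_derive t 1 e c, `|c| <= 2 & t < T0 -> `|U t + c| <= 1]} ->
  d 0 = 0 -> e 0 = 0 -> d S = 0 -> e S = 0 ->
  0 <= \int[mu]_(t in `[0, S]) (X t * d t).
Proof.
move=> [XYU Xopt] S0 T0S XY0 acd ace de d0 e0 dS eS.
have acXY := fuller_traj_infty_abs_continuous XYU.
have [[_ U1] _ XYdt [X0 Y0]] := XYU S S0.
have [acX acY] := acXY S.
pose B := \int[mu]_(t in `[0, S]) (X t * d t).
pose C := \int[mu]_(t in `[0, S]) (d t * d t).
have C0 : 0 <= C by apply: Rintegral_ge0 => t _; rewrite -expr2 sqr_ge0.
suff key k : 0 < k <= 2^-1 -> 0 <= 2 * k * B + k ^+ 2 * C.
  rewrite -/B leNgt; apply/negP => B0.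
  (* as C >= 0, this gives k <= 1/2 and k C <= - B / 2 < - 2 B *)
  pose k := - B / (2 * (C - B)).
  have CB : 0 < C - B by lra.
  have kE : k * (2 * (C - B)) = - B by rewrite /k divfK// gt_eqF// mulr_gt0.
  have k0 : 0 < k by rewrite /k divr_gt0// ?mulr_gt0//; lra.
  have k2 : k <= 2^-1 by rewrite /k ler_pdivrMr ?mulr_gt0//; lra.
  have := key k; rewrite k0 k2 => /(_ isT).
  have : 0 < k * k by rewrite mulr_gt0.
  nra.
move=> /andP[k0 k2].
pose Xk t := X t + k * d (Num.min t S).
pose Yk t := Y t + k * e (Num.min t S).
have minS t : t < S -> Num.min t S = t by move=> tS; apply/min_idPl; exact: ltW.
have minS' t : S <= t -> Num.min t S = S by move=> tS; exact/min_idPr.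
have min0 : Num.min 0 S = 0 by exact/min_idPl.
have [||||u' Xk_traj] := @fuller_traj_infty_of_controlled R x0 y0 Xk Yk.
- move=> T; have [? ?] := acXY T; split; apply: abs_continuousD => //;
  by apply: abs_continuousZ; apply: abs_continuous_min.
- have aeT : {ae mu, forall t, t <> S /\ t <> T0}.
    by apply: filterI; exact: ae_neq.
  apply: filterS3 XYdt de aeT => t XYt det [/eqP tS /eqP tT0].
  rewrite /= in_itv/= andbT => t0.
  have [St|St] := ltP S t.
    have near0 (f g : R -> R) : (forall s, S <= s -> f s = 0) -> \forall s \near t, 0 = f s.
      by move=> f0; apply: (@near_lt_eq _ _ S (t + 1)) => [|s /andP[/ltW/f0]//]; lra.
    have XkS s : S <= s -> Xk s = 0.
      move=> Ss; rewrite /Xk minS'// dS mulr0 addr0.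
      by case: (XY0 s) => //; exact: le_trans Ss.
    have YkS s : S <= s -> Yk s = 0.
      move=> Ss; rewrite /Yk minS'// eS mulr0 addr0.
      by case: (XY0 s) => //; exact: le_trans Ss.
    rewrite YkS ?(ltW St)//; split.
      exact: near_eq_is_derive (near0 _ Xk XkS) (is_derive_cst 0 t 1).
    exists 0; rewrite ?normr0//.
    exact: near_eq_is_derive (near0 _ Yk YkS) (is_derive_cst 0 t 1).
  have {tS}tS : t < S by rewrite lt_neqAle tS.
  have tt : 0 < t < S by rewrite t0.
  have [Xt Yt] := XYt tt; have [dt [c [et c2 Uc]]] := det tt.
  have nearS (f g : R -> R) :
      \forall s \near t, f s + k * g s = f s + k * g (Num.min s S).
    by apply: near_lt_eq tt _ => s /andP[_ sS]; rewrite minS.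
  have Ut1 : `|U t| <= 1 by apply: U1; rewrite !ltW.
  split.
    rewrite /Yk minS//.
    exact: near_eq_is_derive (nearS X d) (is_derive_lincomb k Xt dt).
  exists (U t + k * c).
    have [tT|Tt] := ltP t T0.
      move: (Uc tT) Ut1; rewrite !ler_norml => /andP[? ?] /andP[? ?].
      by apply/andP; split; nra.
    have -> : U t = 0.
      apply: (is_derive_uniq Yt).
      apply: near_eq_is_derive (is_derive_cst 0 t 1).
      apply: (@near_lt_eq _ _ T0 (t + 1)) => [|s /andP[/ltW/XY0[_ ->]]//].
      by rewrite lt_neqAle eq_sym tT0 Tt/= ltrDl.
    by rewrite add0r normrM gtr0_norm//; nra.
  exact: near_eq_is_derive (nearS Y e) (is_derive_lincomb k Yt et).
- by rewrite /Xk min0 d0 mulr0 addr0.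
- by rewrite /Yk min0 e0 mulr0 addr0.
have := Xopt _ _ _ Xk_traj.
have XS t : S <= t -> X t = 0.
  by move=> St; case: (XY0 t) => //; exact: le_trans St.
have XkS t : S <= t -> Xk t = 0.
  by move=> St; rewrite /Xk minS'// dS mulr0 addr0 XS.
have cX := abs_continuous_within acX.
have cd := abs_continuous_within acd.
have acXk : abs_continuous 0 S Xk.
  by have [] := fuller_traj_infty_abs_continuous Xk_traj S.
have cXk := abs_continuous_within acXk.
rewrite (fuller_cost_inftyE cX S0 XS) (fuller_cost_inftyE cXk S0 XkS).
rewrite !fuller_costE// lee_fin ler_pM2l ?invr_gt0//.
rewrite [leRHS](_ : _ = \int[mu]_(t in `[0, S]) ((X t + k * d t) * (X t + k * d t))).
  by rewrite integral_sq_lincomb// -/B -/C; lra.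
apply: eq_Rintegral => t; rewrite inE/= in_itv/= => /andP[_ tS].
by rewrite /Xk; congr (_ * _); congr (_ + _ * d _); exact/min_idPl.
Qed.

End Fuller.

(** * The optimal trajectory and its stopping time *)

Section FullerSynthesis.
Context {R : realType}.
Notation mu := (@lebesgue_measure R).
Implicit Types (S T : R) (f g u d : R -> R).

Lemma optimal_variation_competitor (x0 y0 : R) X Y U X' Y' U' S :
  fuller_optimal_infty x0 y0 X Y U -> fuller_traj_infty x0 y0 X' Y' U' -> 0 <= S ->
  (forall t, S <= t -> X t = 0 /\ Y t = 0) ->
  (forall t, S <= t -> X' t = 0 /\ Y' t = 0) ->
  0 <= \int[mu]_(t in `[0, S]) (X t * (X' t - X t)).
Proof.
move=> opt tr S0 XY0 XY0'; have [tr' _] := opt.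
have [acX acY] := fuller_traj_infty_abs_continuous tr' S.
have [acX' acY'] := fuller_traj_infty_abs_continuous tr S.
have [[_ U1] _ XYdt [X0 Y0]] := tr' S S0.
have [[_ U1'] _ XYdt' [X0' Y0']] := tr S S0.
have [XS YS] := XY0 S (lexx S); have [XS' YS'] := XY0' S (lexx S).
apply: (optimal_variation opt S0 (lexx S) XY0
  (abs_continuousB acX' acX) (abs_continuousB acY' acY)).
- apply: filterS2 XYdt XYdt' => t XYt XYt' tS.
  have [Xt Yt] := XYt tS; have [Xt' Yt'] := XYt' tS.
  split; first exact: is_derive_sub.
  exists (U' t - U t).
  have tS' : 0 <= t <= S by case/andP: tS => /ltW -> /ltW ->.
  split; first exact: is_derive_sub.
  + by apply: le_trans (ler_normB _ _) _; have := U1 _ tS'; have := U1' _ tS'; lra.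
  + by move=> _; rewrite addrC subrK U1'.
- by rewrite X0 X0' subrr.
- by rewrite Y0 Y0' subrr.
- by rewrite XS XS' subrr.
- by rewrite YS YS' subrr.
Qed.

Lemma integral_self_difference S f g :
  {within `[0, S], continuous f} -> {within `[0, S], continuous g} ->
  \int[mu]_(t in `[0, S]) (f t * f t) =
  \int[mu]_(t in `[0, S]) (g t * g t)
  + 2 * \int[mu]_(t in `[0, S]) (g t * (f t - g t))
  + \int[mu]_(t in `[0, S]) ((f t - g t) * (f t - g t)).
Proof.
move=> cf cg; have cfg : {within `[0, S], continuous (fun t => f t - g t)}.
  by move=> t; apply: continuousB; [exact: cf|exact: cg].
have := integral_sq_lincomb 1 cg cfg; rewrite mulr1 expr1n mul1r => <-.
by apply: eq_Rintegral => t _; ring.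
Qed.

(** Each of two optimal trajectories is an admissible variation of the other.
    Adding the two first-order inequalities, the integral of X (X' - X) and that
    of X' (X - X'), shows that the integral of (X - X')^2 is nonpositive. *)
Lemma fuller_optimal_infty_unique (x0 y0 : R) X Y U X' Y' U' T T' :
  fuller_optimal_infty x0 y0 X Y U -> fuller_optimal_infty x0 y0 X' Y' U' ->
  0 <= T -> (forall t, T <= t -> X t = 0 /\ Y t = 0) ->
  (forall t, T' <= t -> X' t = 0 /\ Y' t = 0) ->
  forall t, 0 <= t -> X t = X' t /\ Y t = Y' t.
Proof.
move=> opt opt' T0 XY0 XY0'.
pose S := Num.max T T'.
have S0 : 0 <= S by rewrite /S le_max T0.
have XYS t : S <= t -> X t = 0 /\ Y t = 0.
  by rewrite /S ge_max => /andP[/XY0].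
have XYS' t : S <= t -> X' t = 0 /\ Y' t = 0.
  by rewrite /S ge_max => /andP[_ /XY0'].
have v1 := optimal_variation_competitor opt opt'.1 S0 XYS XYS'.
have v2 := optimal_variation_competitor opt' opt.1 S0 XYS' XYS.
have tr := opt.1; have tr' := opt'.1.
have acXY := fuller_traj_infty_abs_continuous tr.
have acXY' := fuller_traj_infty_abs_continuous tr'.
have cX := abs_continuous_within (acXY S).1.
have cX' := abs_continuous_within (acXY' S).1.
have dd0 : \int[mu]_(t in `[0, S]) ((X t - X' t) * (X t - X' t)) <= 0.
  have e1 := integral_self_difference cX cX'.
  have e2 := integral_self_difference cX' cX.
  have e3 : \int[mu]_(t in `[0, S]) ((X t - X' t) * (X t - X' t)) =
      \int[mu]_(t in `[0, S]) ((X' t - X t) * (X' t - X t)).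
    by apply: eq_Rintegral => t _; ring.
  by rewrite -e3 in e2; lra.
have cd := abs_continuousB_within (acXY S).1 (acXY' S).1.
have [_ _ _ [X0 Y0]] := tr 0 (lexx 0).
have [_ _ _ [X0' Y0']] := tr' 0 (lexx 0).
have XX t : 0 <= t -> X t = X' t.
  rewrite le_eqVlt => /predU1P[<-|t0]; first by rewrite X0 X0'.
  have [St|tS] := leP S t; first by rewrite (XYS t St).1 (XYS' t St).1.
  by apply/eqP; rewrite -subr_eq0 (continuous_sq_integral_eq0 cd dd0)// t0.
move=> t t0; split; first exact: XX.
move: t0; rewrite le_eqVlt => /predU1P[<-|t0]; first by rewrite Y0 Y0'.
have T1 : 0 <= t + 1 by lra.
have [_ _ dX _] := tr _ T1; have [_ _ dX' _] := tr' _ T1.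
apply: (@velocity_unique R (t + 1) X Y X' Y' (acXY _).2 (acXY' _).2).
- by apply: filterS dX => s H /H[].
- by apply: filterS dX' => s H /H[].
- by move=> s /andP[s0 _]; apply: XX; exact: ltW.
- by rewrite t0 ltrDl ltr01.
Qed.

Lemma abs_continuous_eq0_right T f (r : R) : abs_continuous 0 T f -> 0 <= r -> r < T ->
  (forall t, r < t -> f t = 0) -> f r = 0.
Proof.
move=> acf r0 rT f0; apply/eqP; rewrite -normr_eq0 eq_le normr_ge0 andbT.
apply/ler_addgt0Pr => e e0; rewrite add0r.
have [d d0 H] := abs_continuous_dist acf e0.
pose h := Num.min (d / 2) (T - r).
have h0 : 0 < h by rewrite lt_min subr_gt0 rT divr_gt0.
have hd : h < d by rewrite gt_min; apply/orP; left; lra.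
have hT : h <= T - r by rewrite ge_min lexx orbT.
rewrite ltW// -(subr0 (f r)) -(f0 (r + h)) ?ltrDl//.
by apply: H; [| |rewrite ltr_distl]; apply/andP; split; lra.
Qed.

Lemma T_F_ge0 (x0 y0 : R) : (0 <= T_F x0 y0)%E.
Proof. by apply: le_ereal_inf_tmp => _ [T [T0 _] <-]; rewrite lee_fin. Qed.

(** Every stopping time comes with its own optimal trajectory, but by uniqueness
    all of them coincide; so a single one rests after each stopping time, and by
    continuity from their infimum on. *)
Lemma T_F_attained (x0 y0 r : R) : T_F x0 y0 = r%:E ->
  exists X Y U, fuller_optimal_infty x0 y0 X Y U /\
    forall t, r <= t -> X t = 0 /\ Y t = 0.
Proof.
move=> Tr; have r0 : 0 <= r by rewrite -lee_fin -Tr; exact: T_F_ge0.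
have stop_lt t : r < t -> exists2 T, T < t & fuller_stop_time x0 y0 T.
  rewrite -lte_fin -Tr => /ereal_inf_lt[_ [T sT <-]]; rewrite lte_fin => Tt.
  by exists T.
have [|T1 _ [T10 [X [Y [U [opt XY0 _]]]]]] := stop_lt (r + 1); first by rewrite ltrDl.
exists X, Y, U; split => //.
have XYr t : r < t -> X t = 0 /\ Y t = 0.
  move=> rt; have [T Tt [T0 [X' [Y' [U' [opt' XY0' _]]]]]] := stop_lt t rt.
  have [-> ->] := fuller_optimal_infty_unique opt opt' T10
    (fun t h => let: And3 a b _ := XY0 t h in conj a b)
    (fun t h => let: And3 a b _ := XY0' t h in conj a b) (ltW (le_lt_trans r0 rt)).
  by have [] := XY0' _ (ltW Tt).
have [acX acY] := fuller_traj_infty_abs_continuous opt.1 (r + 1).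
move=> t; rewrite le_eqVlt => /predU1P[<-|]; last exact: XYr.
have r1 : r < r + 1 by rewrite ltrDl.
by split; [apply: (abs_continuous_eq0_right acX)|
           apply: (abs_continuous_eq0_right acY)] => // s /XYr[].
Qed.

Lemma J_F_attained (x0 y0 : R) X Y U : fuller_optimal_infty x0 y0 X Y U ->
  J_F x0 y0 = fuller_cost_infty X.
Proof.
move=> [tr opt]; apply/le_anti/andP; split.
  by apply: ereal_inf_lbound; exists X, Y, U.
by apply: le_ereal_inf_tmp => _ [x [y [u [/opt + ->]]]].
Qed.

End FullerSynthesis.

(** * Joining two optimal trajectories at the origin *)

Section FullerBetween.
Context {R : realType}.
Notation mu := (@lebesgue_measure R).
Implicit Types (S T : R) (f g u d : R -> R).

Variables (x0 y0 x1 y1 : R) (X0 Y0 U0 X1 Y1 U1 : R -> R) (T0 T1 T : R).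
Hypothesis opt0 : fuller_optimal_infty x0 y0 X0 Y0 U0.
Hypothesis opt1 : fuller_optimal_infty x1 (- y1) X1 Y1 U1.
Hypothesis T0_ge0 : 0 <= T0.
Hypothesis T1_ge0 : 0 <= T1.
Hypothesis T01 : T0 + T1 <= T.
Hypothesis stop0 : forall t, T0 <= t -> X0 t = 0 /\ Y0 t = 0.
Hypothesis stop1 : forall t, T1 <= t -> X1 t = 0 /\ Y1 t = 0.

Let Xs t := X0 t + X1 (T - t).
Let Ys t := Y0 t - Y1 (T - t).

Let T_ge0 : 0 <= T. Proof. by apply: le_trans T01; exact: addr_ge0. Qed.
Let T0T : T0 <= T. Proof. by apply: le_trans T01; rewrite lerDl. Qed.
Let T1T : T1 <= T. Proof. by apply: le_trans T01; rewrite lerDr. Qed.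

Let acX0 : abs_continuous 0 T X0.
Proof. by case: (fuller_traj_infty_abs_continuous opt0.1 T). Qed.
Let acY0 : abs_continuous 0 T Y0.
Proof. by case: (fuller_traj_infty_abs_continuous opt0.1 T). Qed.
Let acX1 : abs_continuous 0 T X1.
Proof. by case: (fuller_traj_infty_abs_continuous opt1.1 T). Qed.
Let acY1 : abs_continuous 0 T Y1.
Proof. by case: (fuller_traj_infty_abs_continuous opt1.1 T). Qed.
Let acXs : abs_continuous 0 T Xs.
Proof. by apply: abs_continuousD => //; exact: abs_continuous_reflect. Qed.
Let acYs : abs_continuous 0 T Ys.
Proof. by apply: abs_continuousB => //; exact: abs_continuous_reflect. Qed.

Let Xs0 : Xs 0 = x0.
Proof.
have [_ _ _ [h _]] := opt0.1 0 (lexx 0).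
by rewrite /Xs subr0 h (stop1 T1T).1 addr0.
Qed.
Let Ys0 : Ys 0 = y0.
Proof.
have [_ _ _ [_ h]] := opt0.1 0 (lexx 0).
by rewrite /Ys subr0 h (stop1 T1T).2 subr0.
Qed.
Let XsT : Xs T = x1.
Proof.
have [_ _ _ [h _]] := opt1.1 0 (lexx 0).
by rewrite /Xs subrr h (stop0 T0T).1 add0r.
Qed.
Let YsT : Ys T = y1.
Proof.
have [_ _ _ [_ h]] := opt1.1 0 (lexx 0).
by rewrite /Ys subrr h (stop0 T0T).2 sub0r opprK.
Qed.

(** A control vanishes once its trajectory rests, so that at almost every time
    at most one of the two controls below is nonzero. *)
Let derive_concat : {ae mu, forall t, 0 < t < T ->
  [/\ is_derive t 1 Xs (Ys t), is_derive t 1 Ys (U0 t + U1 (T - t)),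
      `|U0 t| <= 1 /\ `|U1 (T - t)| <= 1,
      T0 < t -> U0 t = 0 & T1 < T - t -> U1 (T - t) = 0]}.
Proof.
have [[_ U01] _ d0 _] := opt0.1 T T_ge0.
have [[_ U11] _ /(ae_reflect T) d1 _] := opt1.1 T T_ge0.
apply: filterS2 d0 d1 => t d0 d1 tT.
have tT' : 0 < T - t < T by lra.
have [Xt Yt] := d0 tT; have [Xt' Yt'] := d1 tT'.
have stopU (Y U : R -> R) (S s : R) : (forall r, S <= r -> Y r = 0) -> S < s ->
    is_derive s 1 Y (U s) -> U s = 0.
  move=> YS Ss Ys'; apply: (is_derive_uniq Ys').
  apply: near_eq_is_derive (is_derive_cst 0 s 1).
  by apply: (@near_lt_eq _ _ _ S (s + 1)) => [|r /andP[/ltW/YS]//]; rewrite Ss ltrDl ltr01.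
split.
- exact: is_deriveD Xt (is_derive_reflect Xt').
- have := is_derive_sub Yt (is_derive_reflect Yt').
  by rewrite opprK.
- by split; [apply: U01|apply: U11]; lra.
- by move=> Tt; apply: (stopU Y0 U0 T0) => // r /stop0[].
- by move=> Tt; apply: (stopU Y1 U1 T1) => // r /stop1[].
Qed.

Lemma concat_fuller_traj : exists u, fuller_traj_between x0 y0 x1 y1 T Xs Ys u.
Proof.
have [|u tr] := fuller_traj_of_controlled acXs acYs _ Xs0 Ys0; last first.
- by exists u; split.
- have aeT : {ae mu, forall t, t <> T0 /\ t <> T - T1}.
    by apply: filterI; exact: ae_neq.
  apply: filterS2 derive_concat aeT => t dt [/eqP tT0 /eqP tT1].
  rewrite /= in_itv/= => /dt[Xt Yt [u0 u1] z0 z1]; split => //.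
  exists (U0 t + U1 (T - t)) => //.
  have [Tt|tT] := ltP T0 t; first by rewrite z0// add0r.
  rewrite z1 ?addr0//.
  have tT0' : t < T0 by rewrite lt_neqAle tT0.
  by have := T01; lra.
Qed.

(** The cross term of the square is zero because one of the two trajectories
    rests at each time. *)
Lemma concat_cost : fuller_cost T Xs = (fuller_cost_infty X0 + fuller_cost_infty X1)%E.
Proof.
have cX0 := abs_continuous_within acX0.
have cX1 := abs_continuous_within acX1.
have cX1' := abs_continuous_within (abs_continuous_reflect acX1).
have cXs := abs_continuous_within acXs.
rewrite (fuller_cost_inftyE cX0 T_ge0); last first.
  by move=> t Tt; case: (stop0 (le_trans T0T Tt)).
rewrite (fuller_cost_inftyE cX1 T_ge0); last first.
  by move=> t Tt; case: (stop1 (le_trans T1T Tt)).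
rewrite !fuller_costE// -EFinD -mulrDr.
have := integral_sq_lincomb 1 cX0 cX1'; rewrite !mulr1 expr1n mul1r.
rewrite (@Rintegral_reflect _ _ (fun t => X1 t * X1 t))//; last exact: within_continuousM.
have -> : \int[mu]_(t in `[0, T]) (X0 t * X1 (T - t)) = 0.
  rewrite /Rintegral integral0_eq// => t; rewrite /= in_itv/= => /andP[t0 tT].
  have [Tt|tT0] := leP T0 t; first by rewrite (stop0 Tt).1 mul0r.
  have T1t : T1 <= T - t by have := T01; lra.
  by rewrite (stop1 T1t).1 mulr0.
rewrite mulr0 addr0 => <-; congr (_ * _)%:E.
by apply: eq_Rintegral => t _; rewrite mul1r.
Qed.

(** The difference d to any competitor vanishes to first order at both ends,
    so it is a variation of X0, and its time reversal is one of X1.  Hence the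
    linear term of the cost is nonnegative and the quadratic one remains. *)
Lemma concat_strictly_optimal x y u : fuller_traj_between x0 y0 x1 y1 T x y u ->
  \int[mu]_(t in `[0, T]) (Xs t * Xs t) +
    \int[mu]_(t in `[0, T]) ((x t - Xs t) * (x t - Xs t)) <=
  \int[mu]_(t in `[0, T]) (x t * x t).
Proof.
move=> [[[_ u1] [acx acy] dxy [xx yy]] xT yT].
pose d t := x t - Xs t; pose e t := y t - Ys t.
have acd : abs_continuous 0 T d by exact: abs_continuousB.
have ace : abs_continuous 0 T e by exact: abs_continuousB.
have cx := abs_continuous_within acx.
have cXs := abs_continuous_within acXs.
have cd := abs_continuous_within acd.
have cd' := abs_continuous_within (abs_continuous_reflect acd).
have cX0 := abs_continuous_within acX0.
have cX1 := abs_continuous_within acX1.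
have cX1' := abs_continuous_within (abs_continuous_reflect acX1).
have aeT : {ae mu, forall t, t <> T0 /\ t <> T - T1}.
  by apply: filterI; exact: ae_neq.
have de : {ae mu, forall t, 0 < t < T -> is_derive t 1 d (e t) /\
    exists c, [/\ is_derive t 1 e c, `|c| <= 2,
      t < T0 -> `|U0 t + c| <= 1 & T - t < T1 -> `|U1 (T - t) + c| <= 1]}.
  apply: filterS3 dxy derive_concat aeT => t xyt st [/eqP tT0 /eqP tT1] tT.
  have [xt yt] := xyt tT; have [Xt Yt [n0 n1] z0 z1] := st tT.
  have ut : `|u t| <= 1 by apply: u1; lra.
  split; first exact: is_derive_sub.
  exists (u t - (U0 t + U1 (T - t))); split.
  - exact: is_derive_sub.
  - apply: le_trans (ler_normB _ _) _.
    have [Tt|Tt] := ltP T0 t; first by rewrite z0// add0r; lra.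
    have tT0' : t < T0 by rewrite lt_neqAle tT0.
    by rewrite z1 ?addr0; have := T01; lra.
  - move=> tT0'; rewrite z1; last by have := T01; lra.
    by rewrite addr0 subrKC.
  - move=> tT1'; rewrite z0; last by have := T01; lra.
    by rewrite add0r subrKC.
have d0 : d 0 = 0 by rewrite /d xx Xs0 subrr.
have e0 : e 0 = 0 by rewrite /e yy Ys0 subrr.
have dT : d T = 0 by rewrite /d xT XsT subrr.
have eT : e T = 0 by rewrite /e yT YsT subrr.
have v0 : 0 <= \int[mu]_(t in `[0, T]) (X0 t * d t).
  apply: (optimal_variation opt0 T_ge0 T0T stop0 acd ace) => //.
  apply: filterS de => t H /H[dt [c [et c2 c0 _]]]; split => //.
  by exists c.
have v1 : 0 <= \int[mu]_(t in `[0, T]) (X1 t * d (T - t)).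
  apply: (optimal_variation (e := fun t => - e (T - t)) opt1 T_ge0 T1T stop1).
  - exact: abs_continuous_reflect.
  - by apply: abs_continuousN; exact: abs_continuous_reflect.
  - have := ae_reflect T de; apply: filterS => t H tT.
    have [|dt [c [et c2 _ c1]]] := H; first by lra.
    split; first exact: is_derive_reflect.
    exists c; split => //.
      have := is_derive_reflect et => /(is_deriveN); rewrite opprK; exact.
    by move=> tT1; rewrite -[in U1 t](subKr T t) c1//; lra.
  - by rewrite subr0.
  - by rewrite subr0 eT oppr0.
  - by rewrite subrr.
  - by rewrite subrr e0 oppr0.
have split_x := integral_self_difference cx cXs.
suff : 0 <= \int[mu]_(t in `[0, T]) (Xs t * d t) by move: split_x; rewrite /d; lra.
have -> : \int[mu]_(t in `[0, T]) (Xs t * d t) =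
    \int[mu]_(t in `[0, T]) (X0 t * d t) + \int[mu]_(t in `[0, T]) (X1 (T - t) * d t).
  rewrite -RintegralD//; [|exact/continuous_integrable_itv/within_continuousM..].
  by apply: eq_Rintegral => t _; rewrite mulrDl.
rewrite addr_ge0//.
move: v1; rewrite -Rintegral_reflect//; last exact: within_continuousM.
by under eq_Rintegral do rewrite subKr.
Qed.

End FullerBetween.

(** * Bounds on the integral of the speed *)

Section LengthBounds.
Context {R : realType}.
Notation mu := (@lebesgue_measure R).
Implicit Types (T : R) (f g : R -> R).

Import HBNNSimple.

(** The speed of a curve takes uncontrolled values where the curve is not
    differentiable, so it need not be Borel.  The integral, a supremum over
    simple functions from below, is monotone all the same. *)
Lemma ge0_le_integral_nonmeasurable f g :
  (forall t, 0 <= f t) -> (forall t, f t <= g t) ->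
  (\int[mu]_t (f t)%:E <= \int[mu]_t (g t)%:E)%E.
Proof.
move=> f0 fg; have g0 t : 0 <= g t by exact: le_trans (fg t).
rewrite !ge0_integralTE; [|by move=> t; rewrite lee_fin..].
apply: le_ereal_sup => _ [h hf <-]; exists h => // t.
by apply: le_trans (hf t) _; rewrite lee_fin.
Qed.

(** Each simple function below g is measurable, so that it can be compared
    almost everywhere with the indicator of the interval. *)
Lemma integral_ae_le1 T g : 0 <= T -> (forall t, 0 <= g t) ->
  {ae mu, forall t, 0 < t < T -> g t <= 1} ->
  (\int[mu]_(t in `]0%R, T[) (g t)%:E <= T%:E)%E.
Proof.
move=> T0 g0 g1; rewrite integral_mkcond ge0_integralTE; last first.
  by move=> t; rewrite patchE; case: ifP => // _; rewrite lee_fin.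
apply: ge_ereal_sup => _ [h hg <-]; rewrite -integralT_nnsfun.
have -> : T%:E = (\int[mu]_t (\1_(`]0, T[) t)%:E)%E.
  rewrite integral_indic// setIT [RHS]lebesgue_measure_itv/= lte_fin.
  by case: ltP => [|T0']; [rewrite oppr0 addr0|congr (_%:E); apply/le_anti; rewrite T0 T0'].
apply: ae_ge0_le_integral.
- exact: measurableT.
- by move=> t _; rewrite lee_fin.
- exact/measurable_EFinP.
- by move=> t _; rewrite lee_fin.
- exact/measurable_EFinP/measurable_indic.
apply: filterS g1 => t gt _; apply: le_trans (hg t) _.
rewrite patchE indicE; case: ifP => //= tT; rewrite lee_fin; apply: gt.
by move: tT; rewrite inE/= in_itv.
Qed.

(** On a Borel set of full measure |f'| is measurable and at most g; its
    primitive is differentiable almost everywhere with derivative |f'|, and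
    [abs_continuous_le] compares it with f. *)
Lemma increment_le_integral T f g : 0 <= T -> abs_continuous 0 T f ->
  (forall t, 0 <= g t) ->
  {ae mu, forall t, 0 < t < T -> exists2 c, is_derive t 1 f c & `|c| <= g t} ->
  ((f T - f 0)%:E <= \int[mu]_(t in `]0%R, T[) (g t)%:E)%E.
Proof.
move=> T0 acf g0 [N [mN N0 HN]].
have mD : measurable (`]0, T[ `\` N) by exact: measurableD.
have dD t : (`]0, T[ `\` N) t ->
    [/\ 0 < t < T, is_derive t 1 f ('D_1 f t) & `|'D_1 f t| <= g t].
  move=> [It Nt]; have tT : 0 < t < T by move: It; rewrite /= in_itv.
  have [c fc cg] : exists2 c, is_derive t 1 f c & `|c| <= g t.
    by apply: contrapT => h; apply: Nt; apply: HN => /= /(_ tT).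
  by rewrite (@derive_val _ _ _ _ _ _ _ fc).
pose phi := (fun t => `|'D_1 f t|) \_ (`]0, T[ `\` N).
have phi0 t : 0 <= phi t by rewrite /phi patchE; case: ifP.
have mphi : measurable_fun setT phi.
  apply/(measurable_restrictT _ _).1 => //; apply: measurableT_comp => //.
  apply: (measurable_derivative _ mD _ (abs_continuous_in acf)) => [|t []|t /dD[]] //.
set L := (\int[mu]_(t in _) _)%E.
have phiL : (\int[mu]_t (phi t)%:E <= L)%E.
  rewrite /L [leRHS]integral_mkcond.
  rewrite (_ : (fun t => (g t)%:E) \_ _ = EFin \o (g \_ `]0, T[)); last first.
    by apply/funext => t; rewrite /= !patchE; case: ifP.
  apply: ge0_le_integral_nonmeasurable => // t.
  rewrite /phi !patchE; case: ifPn => [|_].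
    by rewrite inE => tD; rewrite mem_set; [case: (dD t tD)|case: tD].
  by case: ifP.
have [->|Lfin] := eqVneq L +oo%E; first exact: leey.
have iphi : mu.-integrable setT (EFin \o phi).
  apply/integrableP; split; first exact/measurable_EFinP.
  under eq_integral do rewrite /= (ger0_norm (phi0 _)).
  by apply: le_lt_trans phiL _; rewrite ltey.
have iphiS (A : set R) : measurable A -> mu.-integrable A (EFin \o phi).
  by move=> mA; apply: integrableS iphi.
pose F s := \int[mu]_(t in `[0, s]) phi t.
have Ffin s : (\int[mu]_(t in `[0%R, s]) (phi t)%:E)%E \is a fin_num.
  exact: integrable_fin_num (iphiS _ (measurable_itv _)).
have mphiE (A : set R) : measurable_fun A (EFin \o phi).
  by apply/measurable_EFinP; exact: measurable_funTS.
have F_mono s t : 0 <= s -> s <= t -> t <= T -> F s <= F t.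
  move=> s0 st tT; apply: fine_le => //; apply: ge0_subset_integral => //.
  - exact: mphiE.
  - by move=> r _; rewrite lee_fin.
  - by apply: subset_itvl; rewrite bnd_simp.
have locphi : locally_integrable setT phi.
  by apply: open_integrable_locally => //; exact: openT.
have dF : {ae mu, forall t : R, 0 < t -> is_derive t 1 F (phi t)}.
  have := FTC1 (a := BLeft 0) (fun y => iphiS _ (measurable_itv _)) locphi.
  apply: filterS => t H t0; have [|dF F't] := H; first by rewrite lte_fin.
  by rewrite -F't derive1E; exact: DeriveDef.
have : f T - f 0 <= F T - F 0.
  apply: abs_continuous_le => //.
  have aeN : {ae mu, forall t, ~ N t}.
    by exists N; split => // t /= /contrapT.
  apply: filterS2 dF aeN => t dF Nt tT.
  have tD : (`]0, T[ `\` N) t by split => //=; rewrite in_itv.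
  have [_ ft _] := dD t tD; exists ('D_1 f t), (phi t); split => //.
    by apply: dF; case/andP: tT.
  by rewrite /phi patchE mem_set// ler_norm.
have F00 : 0 <= F 0 by exact: Rintegral_ge0.
move=> fF; apply: le_trans (_ : (F T)%:E <= _)%E; first by rewrite lee_fin; lra.
apply: le_trans phiL; rewrite /F /Rintegral fineK//.
apply: ge0_subset_integral => //; first exact: mphiE.
by move=> t _; rewrite lee_fin.
Qed.

End LengthBounds.

(** * Curves in four dimensions *)

Section FinslerCurves.
Context {R : realType}.
Notation mu := (@lebesgue_measure R).
Implicit Types (T : R) (f g : R -> R) (q : R -> 'rV[R]_4).

Lemma abs_continuous_derive0 (a b : R) f : abs_continuous a b f ->
  {ae mu, forall t, a < t < b -> is_derive t 1 f 0} ->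
  forall t, a <= t <= b -> f t = f a.
Proof.
move=> acf df t /andP[at_ tb].
have acf' : abs_continuous a t f by exact: abs_continuousS acf.
have df' : {ae mu, forall s, a < s < t -> is_derive s 1 f 0}.
  by apply: filterS df => s H /andP[as_ st]; apply: H; rewrite as_ (lt_le_trans st).
apply/le_anti/andP; split; rewrite -subr_le0.
  have := abs_continuous_le (F := cst 0) at_ acf'; rewrite subrr; apply => //.
  apply: filterS df' => s H /H fs; exists 0, 0; split => //.
  exact: is_derive_cst.
have := abs_continuous_le (F := cst 0) at_ (abs_continuousN acf').
rewrite subrr opprK addrC; apply => //.
apply: filterS df' => s H /H fs; exists 0, 0; split => //; last exact: is_derive_cst.
by have := is_deriveN fs; rewrite oppr0.
Qed.

Lemma primitive_sq (z0 : R) T f : 0 <= T -> {within `[0, T], continuous f} ->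
  let z t := z0 + 2^-1 * \int[mu]_(s in `[0, t]) (f s ^+ 2) in
  abs_continuous 0 T z /\
  forall t, 0 < t < T -> is_derive t 1 z (2^-1 * f t ^+ 2).
Proof.
move=> T0 cf z.
have cff : {within `[0, T], continuous (fun s => f s ^+ 2)}.
  exact: (within_continuousM cf cf).
have iff := continuous_integrable_itv cff.
split.
  have [c _ fc] := EVT_max T0 cff.
  apply: (@abs_continuous_lipschitz _ _ _ (2^-1 * f c ^+ 2)).
    by rewrite mulr_ge0 ?sqr_ge0.
  move=> s t s0 st tT.
  have ift : mu.-integrable `[0, t] (EFin \o (fun s => f s ^+ 2)).
    by apply: integrableS iff => //; apply: subset_itvl; rewrite bnd_simp.
  have -> : z t - z s = 2^-1 * \int[mu]_(r in `]s, t]) (f r ^+ 2).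
    rewrite /z -(@Rintegral_itvB _ _ _ _ s ift) ?bnd_simp//; ring.
  rewrite normrM gtr0_norm// -mulrA ler_pM2l// ger0_norm; last first.
    by apply: Rintegral_ge0 => r _; exact: sqr_ge0.
  have -> : f c ^+ 2 * (t - s) = \int[mu]_(r in `]s, t]) (cst (f c ^+ 2) r).
    rewrite Rintegral_cst//; congr (_ * _).
    rewrite [X in _ = fine X]lebesgue_measure_itv/= lte_fin; case: ltP => //= ts.
    by rewrite (_ : t = s) ?subrr//; apply/le_anti; rewrite ts.
  have ict : mu.-integrable `[0, t] (EFin \o cst (f c ^+ 2)).
    by apply: continuous_integrable_itv => ?; exact: cst_continuous.
  have sub0t : `]s, t] `<=` `[0, t].
    by move=> r /=; rewrite !in_itv/= => /andP[sr ->]; rewrite ltW ?(le_lt_trans s0).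
  apply: le_Rintegral => //.
  - exact: integrableS ift.
  - exact: integrableS ict.
  - move=> r; rewrite /= in_itv/= => /andP[sr rt]; apply: fc.
    by rewrite in_itv/= (le_trans rt tT) ltW// (le_lt_trans s0).
move=> t /andP[t0 tT].
have ctff : {for t, continuous (fun s => f s ^+ 2)}.
  have T0' : 0 < T by exact: lt_trans tT.
  have /(continuous_within_itvP _ T0')[+ _ _] := cff.
  by apply; rewrite in_itv/= t0.
have [dF F'] := continuous_FTC1_closed tT iff t0 ctff.
have dF' : is_derive t 1 (fun t => \int[mu]_(s in `[0, t]) (f s ^+ 2)) (f t ^+ 2).
  by rewrite -F' derive1E; exact: DeriveDef.
by have := is_derive_lincomb 2^-1 (is_derive_cst z0 t 1) dF'; rewrite add0r.
Qed.

Lemma normr_coord n (v : 'rV[R]_n) i : `|v 0 i| <= `|v|.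
Proof.
rewrite [leRHS]/Num.Def.normr/= mx_normrE.
by apply: le_trans; last exact: (le_bigmax _ _ (0, i)).
Qed.

Lemma abs_continuous_coord n (a b : R) (q : R -> 'rV[R]_n) i :
  abs_continuous a b q -> abs_continuous a b (fun t => q t 0 i).
Proof.
apply: (@abs_continuous_dominated _ _ _ _ _ 1) => // s t _ _ _.
by have := normr_coord (q t - q s) i; rewrite mul1r !mxE.
Qed.

Lemma abs_continuous_row n (a b : R) (q : R -> 'rV[R]_n) :
  (forall i, abs_continuous a b (fun t => q t 0 i)) -> abs_continuous a b q.
Proof.
move=> acq; pose F (s : seq 'I_n) t := \sum_(i <- s) q t 0 i *: delta_mx 0 i : 'rV[R]_n.
have acF s : abs_continuous a b (F s).
  elim: s => [|i s IHs].
    apply: (@abs_continuous_eq _ _ _ _ (fun=> 0)) => [t _|].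
      by rewrite /F big_nil.
    move=> e e0; exists 1 => // m s t _ _ _.
    by under eq_bigr do rewrite subrr normr0; rewrite big1.
  apply: (@abs_continuous_eq _ _ _ _ (fun t => q t 0 i *: delta_mx 0 i + F s t)).
    by move=> t _; rewrite /F big_cons.
  apply: abs_continuousD => //.
  apply: (@abs_continuous_dominated _ _ _ _ _ `|delta_mx 0 i : 'rV[R]_n|) (acq i) => //.
  by move=> r t _ _ _; rewrite -scalerBl normrZ mulrC.
by apply: abs_continuous_eq (acF (index_enum 'I_n)) => t _; rewrite [RHS]row_sum_delta.
Qed.

Lemma finsler_speed_ge0 q t : 0 <= finsler_speed q t.
Proof.
by rewrite /finsler_speed /finsler_norm !addr_ge0// le_max normr_ge0.
Qed.

Lemma derivable_coord q t i : derivable q t 1 -> derivable (fun s => q s 0 i) t 1.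
Proof. by move=> /derivable_mxP; apply. Qed.

Lemma finsler_speedE q t : derivable q t 1 -> finsler_speed q t =
  Num.max `|'D_1 (fun s => q s 0 1) t| `|'D_1 (fun s => q s 0 3) t|
  + `|'D_1 (fun s => q s 0 0) t - q t 0 1 * 'D_1 (fun s => q s 0 3) t|
  + `|'D_1 (fun s => q s 0 2) t - 2^-1 * q t 0 0 ^+ 2 * 'D_1 (fun s => q s 0 3) t|.
Proof. by move=> dq; rewrite /finsler_speed derive_mx// /finsler_norm !mxE. Qed.

Lemma finsler_speed_ge_w q t : derivable q t 1 ->
  `|'D_1 (fun s => q s 0 3) t| <= finsler_speed q t.
Proof.
move=> dq; rewrite finsler_speedE// -addrA; set m := Num.max _ _.
apply: (@le_trans _ _ m); first by rewrite le_max lexx orbT.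
by rewrite lerDl addr_ge0.
Qed.

Lemma curve_length_ge (q0 q1 : 'rV[R]_4) T q : curve_between q0 q1 T q ->
  ((q1 0 3 - q0 0 3)%:E <= curve_length T q)%E.
Proof.
move=> [T0 acq dq <- <-].
apply: (@increment_le_integral _ _ (fun t => q t 0 3)) => //.
- exact: abs_continuous_coord.
- exact: finsler_speed_ge0.
- apply: filterS dq => t H /H dqt; exists ('D_1 (fun s => q s 0 3) t).
    by apply: DeriveDef => //; exact: derivable_coord.
  exact: finsler_speed_ge_w.
Qed.

End FinslerCurves.

(** * Shortest paths *)

Section ShortestPaths.
Context {R : realType}.
Notation mu := (@lebesgue_measure R).

(** [T_F] is an infimum over a set that might be empty; the bound on the sum makes
    both values finite and thereby supplies the two optimal trajectories.  Both
    [xF] and any competitor of the same cost are then compared with the joined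
    trajectory. *)
Lemma fuller_between_unique (x0 y0 x1 y1 z T : R) (xF yF : R -> R) :
  (z%:E = J_F x0 y0 + J_F x1 (- y1))%E ->
  (T_F x0 y0 + T_F x1 (- y1) <= T%:E)%E ->
  fuller_optimal_between x0 y0 x1 y1 T xF yF ->
  [/\ 0 <= T, fuller_cost T xF = z%:E
    & forall x y u, fuller_traj_between x0 y0 x1 y1 T x y u ->
      (fuller_cost T x <= z%:E)%E ->
      forall t, 0 <= t <= T -> x t = xF t /\ y t = yF t].
Proof.
move=> zJ TT [[uF trF] optF].
have F0 := T_F_ge0 x0 y0; have F1 := T_F_ge0 x1 (- y1).
case E0 : (T_F x0 y0) => [r0| |]; rewrite E0 in F0 TT; last by [].
  2: by move: TT; rewrite addye// gt_eqF// (lt_le_trans _ F1)// ltNyr.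
case E1 : (T_F x1 (- y1)) => [r1| |]; rewrite E1 in F1 TT => //.
rewrite -EFinD lee_fin in TT; rewrite !lee_fin in F0 F1.
have [X0 [Y0 [U0 [opt0 stop0]]]] := T_F_attained E0.
have [X1 [Y1 [U1 [opt1 stop1]]]] := T_F_attained E1.
have T0 : 0 <= T by apply: le_trans TT; exact: addr_ge0.
rewrite (J_F_attained opt0) (J_F_attained opt1) in zJ.
have [us trs] := concat_fuller_traj opt0 opt1 F0 F1 TT stop0 stop1.
have := concat_cost opt0 opt1 F0 F1 TT stop0 stop1; rewrite -zJ.
have := concat_strictly_optimal opt0 opt1 F0 F1 TT stop0 stop1.
move: trs.
set Xs := (fun t => X0 t + X1 (T - t)); set Ys := (fun t => Y0 t - Y1 (T - t)).
move=> trs strict costs.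
have [[_ [acXs acYs] dXYs [Xs0 Ys0]] XsT YsT] := trs.
have cXs := abs_continuous_within acXs.
have uniq x y u : fuller_traj_between x0 y0 x1 y1 T x y u ->
    (fuller_cost T x <= z%:E)%E -> forall t, 0 <= t <= T -> x t = Xs t /\ y t = Ys t.
  move=> trx; have [[_ [acx acy] dxy [xx yy]] xT yT] := trx.
  have cx := abs_continuous_within acx.
  rewrite -costs !fuller_costE// lee_fin ler_pM2l ?invr_gt0// => cost_le.
  have := strict _ _ _ trx; rewrite -[leRHS]add0r => st.
  have d0 : \int[mu]_(t in `[0, T]) ((x t - Xs t) * (x t - Xs t)) <= 0 by lra.
  have xX t : 0 < t < T -> x t = Xs t.
    move=> tT; apply/eqP; rewrite -subr_eq0.
    by rewrite (continuous_sq_integral_eq0 (abs_continuousB_within acx acXs) d0).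
  have yY t : 0 < t < T -> y t = Ys t.
    apply: (velocity_unique acy acYs _ _ xX).
      by apply: filterS dxy => s H /H[].
    by apply: filterS dXYs => s H /H[].
  move=> t /andP[]; rewrite le_eqVlt => /predU1P[<- _|t0].
    by rewrite xx yy Xs0 Ys0.
  rewrite le_eqVlt => /predU1P[->|tT]; first by rewrite xT yT XsT YsT.
  by rewrite xX ?yY ?t0.
have costF : (fuller_cost T xF <= z%:E)%E by rewrite -costs; exact: optF trs.
have FX := uniq _ _ _ trF costF.
split => //.
- rewrite -costs; congr (_ * _)%E; apply: eq_integral => t.
  by rewrite inE/= in_itv/= => /FX[-> _].
- by move=> x y u trx cx t tT; have [-> ->] := uniq _ _ _ trx cx t tT; have [-> ->] := FX t tT.
Qed.

Definition fuller_lift (z0 w0 : R) (x y : R -> R) (t : R) : 'rV[R]_4 :=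
  vec4 (x t) (y t) (z0 + 2^-1 * \int[mu]_(s in `[0, t]) (x s ^+ 2)) (w0 + t).

Lemma vec4E (x y z w : R) : [/\ vec4 x y z w 0 0 = x, vec4 x y z w 0 1 = y,
  vec4 x y z w 0 2 = z & vec4 x y z w 0 3 = w].
Proof. by rewrite !mxE. Qed.

Lemma vec4_coord (v : 'rV[R]_4) : v = vec4 (v 0 0) (v 0 1) (v 0 2) (v 0 3).
Proof.
apply/rowP => -[[|[|[|[|//]]]] i4]; rewrite mxE /=;
  by congr (v _ _); apply/val_inj.
Qed.

Lemma ord4_cases (i : 'I_4) : [\/ i = 0, i = 1, i = 2 | i = 3].
Proof.
have : i \in [:: 0; 1; 2; 3] by case: i => -[|[|[|[|]]]].
by rewrite !inE => /or4P[] /eqP ->;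
  [constructor 1|constructor 2|constructor 3|constructor 4].
Qed.

Lemma is_derive_shift_time (w t : R) : is_derive t 1 (fun s => w + s) 1.
Proof.
by have := is_deriveD (is_derive_cst w t 1) (is_derive_id t 1); rewrite add0r.
Qed.

(** The lift follows the drift (y, 0, x^2 / 2, 1) plus u times the direction of
    y, and these velocities lie in the unit ball. *)
Lemma fuller_lift_curve (x0 y0 z0 w0 T : R) (x y u : R -> R) :
  0 <= T -> fuller_traj x0 y0 T x y u ->
  let q := fuller_lift z0 w0 x y in
  curve_between (vec4 x0 y0 z0 w0) (q T) T q /\
  {ae mu, forall t, 0 < t < T -> finsler_speed q t <= 1}.
Proof.
move=> T0 [[_ u1] [acx acy] dxy [x00 y00]] q.
have [] := primitive_sq z0 T0 (abs_continuous_within acx).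
set z := (fun t => z0 + _) => acz dz.
pose w t := w0 + t.
have [q0E q1E q2E q3E] : [/\ (fun s => q s 0 0) = x, (fun s => q s 0 1) = y,
    (fun s => q s 0 2) = z & (fun s => q s 0 3) = w].
  by split; apply/funext => s; have [] := vec4E (x s) (y s) (z s) (w s).
have acq : abs_continuous 0 T q.
  have acw : abs_continuous 0 T w.
    apply: (@abs_continuous_lipschitz _ _ _ 1) => // s t _ st _.
    by rewrite mul1r /w opprD addrACA subrr add0r ger0_norm ?subr_ge0.
  by apply: abs_continuous_row => i;
    case: (ord4_cases i) => ->; rewrite ?q0E ?q1E ?q2E ?q3E.
have dq : {ae mu, forall t, 0 < t < T ->
    derivable q t 1 /\ finsler_speed q t <= 1}.
  apply: filterS dxy => t H tT; have [xt yt] := H tT; have zt := dz t tT.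
  have wt : is_derive t 1 w 1 by exact: is_derive_shift_time.
  have dqt : derivable q t 1.
    apply/derivable_mxP => i j; rewrite (ord1 i).
    by case: (ord4_cases j) => ->; rewrite ?q0E ?q1E ?q2E ?q3E; exact: ex_derive.
  split => //; rewrite finsler_speedE// q0E q1E q2E q3E.
  rewrite (is_deriveE xt) (is_deriveE yt) (is_deriveE zt) (is_deriveE wt).
  have [-> -> _ _] := vec4E (x t) (y t) (z t) (w t).
  rewrite !mulr1 !subrr normr0 !addr0 normr1 ge_max lexx andbT.
  by apply: u1; case/andP: tT => /ltW -> /ltW ->.
split; last by apply: filterS dq => t H /H[].
split => //; first by apply: filterS dq => t H /H[].
by rewrite /q /fuller_lift x00 y00 set_itv1 Rintegral_set1 mulr0 !addr0.
Qed.

(** The whole speed is needed to make [w] reach its final value, which leaves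
    none for the last two terms of the norm. *)
Lemma unit_speed_curve_lift (x0 y0 z0 w0 x1 y1 z1 w1 : R) (q : R -> 'rV[R]_4) :
  curve_between (vec4 x0 y0 z0 w0) (vec4 x1 y1 z1 w1) (w1 - w0) q ->
  {ae mu, forall t, 0 < t < w1 - w0 -> finsler_speed q t <= 1} ->
  let x t := q t 0 0 in let y t := q t 0 1 in
  (exists u, fuller_traj_between x0 y0 x1 y1 (w1 - w0) x y u) /\
  forall t, 0 <= t <= w1 - w0 -> q t = fuller_lift z0 w0 x y t.
Proof.
set T := w1 - w0 => -[T0 acq dq qq0 qq1] speedq x y.
pose z t := q t 0 2; pose w t := q t 0 3.
have [acx acy acz acw] : [/\ abs_continuous 0 T x, abs_continuous 0 T y,
    abs_continuous 0 T z & abs_continuous 0 T w].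
  by split; exact: abs_continuous_coord.
have [x00 y00 z00 w00] : [/\ x 0 = x0, y 0 = y0, z 0 = z0 & w 0 = w0].
  by rewrite /x /y /z /w qq0 !mxE.
have [x11 y11 w11] : [/\ x T = x1, y T = y1 & w T = w1].
  by rewrite /x /y /w qq1 !mxE.
have dcoord : {ae mu, forall t, 0 < t < T ->
    derivable q t 1 /\ finsler_speed q t <= 1}.
  by apply: filterS2 dq speedq => t H1 H2 tT; split; [exact: H1|exact: H2].
have isd t i : derivable q t 1 ->
    is_derive t 1 (fun s => q s 0 i) ('D_1 (fun s => q s 0 i) t).
  by move=> dt; apply: DeriveDef => //; exact: derivable_coord.
have w_le a b : 0 <= a -> a <= b -> b <= T -> w b - w a <= b - a.
  move=> a0 ab bt; apply: abs_continuous_le => //; first exact: abs_continuousS acw.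
  apply: filterS dcoord => t H /andP[at_ tb].
  have [|dt sp] := H; first by rewrite (le_lt_trans a0)// (lt_le_trans tb).
  exists ('D_1 w t), 1; split; [exact: isd|exact: is_derive_id|].
  exact: le_trans (ler_norm _) (le_trans (finsler_speed_ge_w dt) sp).
(* the bounds for w on [0, t] and on [t, T] add up to an equality *)
have wE t : 0 <= t <= T -> w t = w0 + t.
  move=> /andP[t0 tT].
  have := w_le _ _ (lexx 0) t0 tT; have := w_le _ _ t0 tT (lexx T).
  by rewrite w00 w11 /T; lra.
have dxyz : {ae mu, forall t, 0 < t < T ->
    [/\ is_derive t 1 x (y t), exists2 c, `|c| <= 1 & is_derive t 1 y c
      & is_derive t 1 z (2^-1 * x t ^+ 2)]}.
  apply: filterS dcoord => t H tT; have [dt sp] := H tT.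
  have wt : is_derive t 1 w 1.
    apply: near_eq_is_derive (is_derive_shift_time w0 t).
    by apply: near_lt_eq tT _ => s /andP[/ltW s0 /ltW sT]; rewrite wE ?s0.
  move: sp; rewrite finsler_speedE// (is_deriveE wt) !mulr1 normr1.
  have := isd t 0 dt; have := isd t 1 dt; have := isd t 2 dt.
  rewrite -/x -/y -/z -/(x t) -/(y t).
  set dx := 'D_1 x t; set dy := 'D_1 y t; set dz := 'D_1 z t => zt yt xt sp.
  have max1 : 1 <= Num.max `|dy| 1 by rewrite le_max lexx orbT.
  have maxy : `|dy| <= Num.max `|dy| 1 by rewrite le_max lexx.
  have nx := normr_ge0 (dx - y t); have nz := normr_ge0 (dz - 2^-1 * x t ^+ 2).
  have /eqP : `|dx - y t| = 0 by lra.
  have /eqP : `|dz - 2^-1 * x t ^+ 2| = 0 by lra.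
  rewrite !normr_eq0 !subr_eq0 => /eqP <- /eqP <-; split => //.
  by exists dy => //; lra.
split.
  have [|u xyu] := fuller_traj_of_controlled acx acy _ x00 y00.
    by apply: filterS dxyz => t H; rewrite /= in_itv/= => /H[].
  by exists u; split.
move=> t tT; rewrite [LHS]vec4_coord -/(x t) -/(y t) -/(z t) -/(w t) wE//.
have [] := primitive_sq z0 T0 (abs_continuous_within acx).
set Z := (fun s => z0 + _) => acZ dZ.
congr vec4; apply/eqP; rewrite -subr_eq0 -/(Z t); apply/eqP.
rewrite (abs_continuous_derive0 (abs_continuousB acz acZ) _ tT).
  by rewrite z00 /Z set_itv1 Rintegral_set1 mulr0 addr0 subrr.
apply: filterS dxyz => s H sT; have [_ _ zs] := H sT.
by have := is_derive_sub zs (dZ s sT); rewrite subrr.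
Qed.

Lemma fuller_lift_end (z0 w0 z1 w1 : R) (x y : R -> R) :
  {within `[0, w1 - w0], continuous x} ->
  (fuller_cost (w1 - w0) x = (z1 - z0)%:E <->
   fuller_lift z0 w0 x y (w1 - w0) =
     vec4 (x (w1 - w0)) (y (w1 - w0)) z1 w1).
Proof.
move=> cx; rewrite fuller_costE// /fuller_lift subrKC.
have -> : \int[mu]_(s in `[0, w1 - w0]) (x s ^+ 2) =
    \int[mu]_(s in `[0, w1 - w0]) (x s * x s) by [].
split=> [[->]|/(congr1 (fun v : 'rV[R]_4 => v 0 2))].
  by rewrite subrKC.
by rewrite !mxE /= => <-; rewrite addrAC subrr add0r.
Qed.

End ShortestPaths.

Theorem theorem3 (R : realType) (x0 y0 z0 w0 x1 y1 z1 w1 : R)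
    (hz : ((z1 - z0)%:E = J_F x0 y0 + J_F x1 (- y1))%E)
    (hw : (T_F x0 y0 + T_F x1 (- y1) <= (w1 - w0)%:E)%E)
    (xF yF : R -> R)
    (hF : fuller_optimal_between x0 y0 x1 y1 (w1 - w0) xF yF) :
  let q0 := vec4 x0 y0 z0 w0 in
  let q1 := vec4 x1 y1 z1 w1 in
  let t1 := w1 - w0 in
  let zF := fun t : R =>
    z0 + 2^-1 * \int[@lebesgue_measure R]_(s in `[0, t]) (xF s ^+ 2) in
  let wF := fun t : R => w0 + t in
  let qF := fun t : R => vec4 (xF t) (yF t) (zF t) (wF t) in
  shortest_path q0 q1 t1 qF /\
  forall (T : R) (q : R -> 'rV[R]_4), shortest_path q0 q1 T q ->
    T = t1 /\ forall t : R, 0 <= t <= t1 -> q t = qF t.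
Proof.
move=> q0 q1 t1 zF wF qF.
have [t1_ge0 costF uniqF] := fuller_between_unique hz hw hF.
have [[uF [trF xFT yFT]] _] := hF.
have [_ [acxF _] _ _] := trF.
have qFT : qF t1 = q1.
  have [+ _] := fuller_lift_end z0 z1 yF (abs_continuous_within acxF).
  by move=> /(_ costF); rewrite xFT yFT.
have [curveF speedF] := fuller_lift_curve z0 w0 t1_ge0 trF.
have qFE : fuller_lift z0 w0 xF yF = qF by [].
rewrite qFE -/t1 qFT in curveF speedF.
have len_ge T q : curve_between q0 q1 T q -> (t1%:E <= curve_length T q)%E.
  by move=> /curve_length_ge; rewrite !mxE.
have lenF : curve_length t1 qF = t1%:E.
  apply/le_anti; rewrite len_ge// andbT; apply: integral_ae_le1 => //.
  exact: finsler_speed_ge0.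
have dist : finsler_dist q0 q1 = t1%:E.
  apply/le_anti/andP; split; first by apply: ereal_inf_lbound; exists t1, qF.
  by apply: le_ereal_inf_tmp => _ [T [q [/len_ge + ->]]].
split; first by split => //; rewrite dist.
move=> T q [curveq lenq speedq Tlen].
have TE : T = t1 by apply: EFin_inj; rewrite Tlen lenq.
rewrite {}TE in curveq speedq * => {Tlen lenq}; split => // t tT.
have [[u tru] qlift] := unit_speed_curve_lift curveq speedq.
set x := (fun s => q s 0 0) in tru qlift.
set y := (fun s => q s 0 1) in tru qlift.
have [[_ [acx _] _ _] xT yT] := tru.
have costx : fuller_cost t1 x = (z1 - z0)%:E.
  apply/(fuller_lift_end z0 z1 y (abs_continuous_within acx)).
  rewrite -/t1 -qlift; last by rewrite t1_ge0 lexx.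
  by have [_ _ _ _ ->] := curveq; rewrite xT yT.
have xyF s : 0 <= s <= t1 -> x s = xF s /\ y s = yF s.
  by move=> sT; apply: (uniqF _ _ _ tru _ s sT); rewrite costx.
rewrite qlift// /fuller_lift /qF /zF; have [-> ->] := xyF t tT; congr vec4.
congr (_ + _ * _); apply: eq_Rintegral => r; rewrite inE/= in_itv/=.
move=> /andP[r0 rt]; have [|-> _ //] := xyF r.
by rewrite r0 (le_trans rt)//; case/andP: tT.
Qed.
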